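(* Let $(\Sigma,g_\Sigma)$ be a closed connected Riemannian manifold of dimension $2$ with area $|\Sigma|=1$, let $L>0$, and let $h:[0,L]\to(0,\infty)$ be a smooth function with $h(0)=h(L)=1$. Let $M=[0,L]\times_h\Sigma$ be the product $[0,L]\times\Sigma$ equipped with the Riemannian metric $g=dt^2+h(t)^2g_\Sigma$. Then, for all $j\ge 1$, \[\sigma_j(h)<\frac{L\lambda_j}{2},\] where $\sigma_j(h)$ denotes the $j$-th Steklov eigenvalue of $M$ and $\lambda_j$ the $j$-th eigenvalue of the Laplacian on $(\Sigma,g_\Sigma)$.
   Context: The Steklov problem on $M=[0,L]\times_h\Sigma$ is $\Delta u=0$ in $M$, $\partial_\nu u=\sigma u$ on $\partial M=\{0,L\}\times\Sigma$, where $\Delta$ is the Laplacian of $g$ and $\nu$ is the outward unit normal. Its eigenvalues, repeated according to multiplicity, are $0=\sigma_0(h)<\sigma_1(h)\le\sigma_2(h)\le\cdots\nearrow+\infty$. The eigenvalues of the (nonnegative) Laplacian on $(\Sigma,g_\Sigma)$, repeated according to multiplicity, are $0=\lambda_0<\lambda_1\le\lambda_2\le\cdots\nearrow+\infty$. *)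

(* Defs.v *)
From HB Require Import structures.
From mathcomp Require Import all_boot all_order all_algebra.
From mathcomp Require Import all_classical all_reals all_analysis.

Set Implicit Arguments.
Unset Strict Implicit.
Unset Printing Implicit Defensive.

Import Order.TTheory GRing.Theory Num.Theory.
Import numFieldNormedType.Exports.

Local Open Scope classical_set_scope.
Local Open Scope ring_scope.

(* [C_k k O f]: all iterated directional derivatives of f of order at most k
   exist and are continuous at every point of O. It is meant for O open and V
   finite-dimensional, where it is the usual class C^k. *)
Fixpoint C_k (R : realType) (V W : normedModType R) (k : nat) (O : set V)
    (f : V -> W) : Prop :=
  (forall x, O x -> {for x, continuous f}) /\
  match k with
  | 0%N => True
  | k'.+1 => forall v : V,
      (forall x, O x -> derivable f x v) /\ C_k k' O (fun x => 'D_v f x)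
  end.

Definition smooth (R : realType) (V W : normedModType R) (O : set V)
    (f : V -> W) : Prop :=
  forall k, C_k k O f.

(* Smoothness on a set that need not be open, e.g. up to the boundary: locally,
   f is the restriction of a smooth function defined on an open set. *)
Definition smooth_within (R : realType) (V W : normedModType R) (A : set V)
    (f : V -> W) : Prop :=
  forall x, A x -> exists (O : set V) (F : V -> W),
    [/\ open O, O x, smooth O F & forall y, A y -> O y -> f y = F y].

(* A Riemannian manifold of dimension n, without boundary, given by a smooth
   atlas and by the matrices of the metric in the charts. The total maps
   [chart i] and [chart_inv i] are only meaningful on [chart_dom i] and [chart_img i]; the
   same holds for [metric i] on [chart_img i]. Tangent vectors are row vectors. The
   distinguished point of the carrier only records that the manifold is
   nonempty. *)
Record riemannian_manifold (R : realType) (n : nat) := RiemannianManifold {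
  space :> ptopologicalType ;
  chart_index : Type ;
  chart_dom : chart_index -> set space ;
  chart_img : chart_index -> set 'rV[R]_n ;
  chart : chart_index -> space -> 'rV[R]_n ;
  chart_inv : chart_index -> 'rV[R]_n -> space ;
  metric : chart_index -> 'rV[R]_n -> 'M[R]_n ;

  space_hausdorff : hausdorff_space space ;
  space_second_countable : @second_countable space ;

  dom_cover : forall p, exists i, chart_dom i p ;
  dom_open : forall i, open (chart_dom i) ;
  codom_open : forall i, open (chart_img i) ;
  chart_codom : forall i p, chart_dom i p -> chart_img i (chart i p) ;
  chart_inv_dom : forall i x, chart_img i x -> chart_dom i (chart_inv i x) ;
  chartK : forall i p, chart_dom i p -> chart_inv i (chart i p) = p ;
  chart_invK : forall i x, chart_img i x -> chart i (chart_inv i x) = x ;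
  chart_continuous : forall i p, chart_dom i p -> {for p, continuous (chart i)} ;
  chart_inv_continuous :
    forall i x, chart_img i x -> {for x, continuous (chart_inv i)} ;
  transition_smooth : forall i j,
    smooth (chart_img i `&` chart_inv i @^-1` chart_dom j) (chart j \o chart_inv i) ;

  metric_smooth : forall i, smooth (chart_img i) (metric i) ;
  metric_sym : forall i x, chart_img i x -> (metric i x)^T = metric i x ;
  metric_posdef : forall i x (v : 'rV[R]_n),
    chart_img i x -> v != 0 -> 0 < (v *m metric i x *m v^T) 0 0 ;
  metric_compat : forall i j x (v w : 'rV[R]_n),
    chart_img i x -> chart_dom j (chart_inv i x) ->
    let tau := chart j \o chart_inv i in
    v *m metric i x *m w^T =
      'd tau x v *m metric j (tau x) *m ('d tau x w)^T
}.

(* div grad u for the metric g on (an open subset of) R^n: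
     det(g)^(-1/2) sum_i d_i (sum_j det(g)^(1/2) g^{ij} d_j u).
   This is a nonpositive operator. *)
Definition laplace_beltrami (R : realType) (n : nat) (g : 'rV[R]_n -> 'M[R]_n)
    (u : 'rV[R]_n -> R) (x : 'rV[R]_n) : R :=
  (Num.sqrt (\det (g x)))^-1 *
  \sum_(i < n) 'D_(delta_mx 0 i) (fun y : 'rV[R]_n =>
    \sum_(j < n) Num.sqrt (\det (g y)) * invmx (g y) i j *
                 'D_(delta_mx 0 j) u y) x.

(* The vector space of restrictions to D of the functions in E has
   dimension d. *)
Definition has_dim (R : realType) (X : Type) (D : set X) (E : set (X -> R))
    (d : nat) : Prop :=
  exists b : 'I_d -> X -> R,
    [/\ forall k, E (b k),
        forall c : 'I_d -> R,
          (forall x, D x -> \sum_(k < d) c k * b k x = 0) -> forall k, c k = 0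
      & forall u, E u -> exists c : 'I_d -> R,
          forall x, D x -> u x = \sum_(k < d) c k * b k x].

(* s lists the eigenvalues, repeated according to multiplicity:
     0 = s_0 < s_1 <= s_2 <= ... -> +oo,
   where E mu is the space of solutions on D of the eigenvalue problem with
   spectral parameter mu. *)
Definition is_spectrum (R : realType) (X : Type) (D : set X)
    (E : R -> set (X -> R)) (s : nat -> R) : Prop :=
  [/\ s 0%N = 0, 0 < s 1%N,
      forall m n, (m <= n)%N -> s m <= s n,
      s n @[n --> \oo] --> +oo
    & forall mu, exists d : nat,
        ([set n | s n = mu] #= `I_d)%card /\ has_dim D (E mu) d].

Definition laplace_eigenspace (R : realType) (n : nat)
    (Sigma : riemannian_manifold R n) (mu : R) : set (Sigma -> R) :=
  [set phi : Sigma -> R | forall i : chart_index Sigma,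
     smooth (chart_img i) (phi \o chart_inv i) /\
     forall x, chart_img i x ->
       - laplace_beltrami (metric i) (phi \o chart_inv i) x =
       mu * phi (chart_inv i x)].

Definition laplace_spectrum (R : realType) (n : nat)
    (Sigma : riemannian_manifold R n) (lam : nat -> R) : Prop :=
  is_spectrum [set: Sigma] (@laplace_eigenspace R n Sigma) lam.

(* The warped product [0, L] x_h Sigma. Its points are the pairs (t, p) : R * Sigma with
   0 <= t <= L, and z : 'rV_(1 + n) has coordinates t = z_0 and
   x = (z_1, ..., z_n), where x is a coordinate of p in a chart of Sigma. *)
Definition warped_carrier (R : realType) (Sigma : Type) (L : R) : set (R * Sigma) :=
  [set q | 0 <= q.1 <= L].

Definition coord_t (R : realType) (n : nat) (z : 'rV[R]_(1 + n)) : R :=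
  lsubmx z 0 0.

Definition warped_codom (R : realType) (n : nat) (Sigma : riemannian_manifold R n)
    (L : R) (i : chart_index Sigma) : set 'rV[R]_(1 + n) :=
  [set z | 0 <= coord_t z <= L /\ chart_img i (rsubmx z)].

Definition warped_interior (R : realType) (n : nat)
    (Sigma : riemannian_manifold R n) (L : R) (i : chart_index Sigma) :
    set 'rV[R]_(1 + n) :=
  [set z | 0 < coord_t z < L /\ chart_img i (rsubmx z)].

Definition warped_chart_inv (R : realType) (n : nat)
    (Sigma : riemannian_manifold R n) (i : chart_index Sigma) (z : 'rV[R]_(1 + n)) : R * Sigma :=
  (coord_t z, chart_inv i (rsubmx z)).

(* dt^2 + h(t)^2 g_Sigma *)
Definition warped_metric (R : realType) (n : nat) (Sigma : riemannian_manifold R n)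
    (h : R -> R) (i : chart_index Sigma) (z : 'rV[R]_(1 + n)) : 'M[R]_(1 + n) :=
  block_mx 1%:M 0 0 (h (coord_t z) ^+ 2 *: metric i (rsubmx z)).

Definition smooth_on_warped (R : realType) (n : nat)
    (Sigma : riemannian_manifold R n) (L : R) (u : R * Sigma -> R) : Prop :=
  forall i : chart_index Sigma, smooth_within (warped_codom L i) (u \o warped_chart_inv i).

(* u is harmonic in the interior, hence on all of M by smoothness. *)
Definition harmonic_on_warped (R : realType) (n : nat)
    (Sigma : riemannian_manifold R n) (L : R) (h : R -> R) (u : R * Sigma -> R) : Prop :=
  forall (i : chart_index Sigma) z, warped_interior L i z ->
    laplace_beltrami (warped_metric h i) (u \o warped_chart_inv i) z = 0.

(* The outward unit normal of dt^2 + h^2 g_Sigma is - d/dt on {0} x Sigma and d/dt on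
   {L} x Sigma; the limits are the one-sided derivatives from inside M. *)
Definition steklov_boundary_condition (R : realType) (Sigma : Type) (L : R)
    (sigma : R) (u : R * Sigma -> R) : Prop :=
  forall p : Sigma,
    (- ((u (e, p) - u (0, p)) / e) @[e --> 0^'+] --> sigma * u (0, p)) /\
    ((u (L, p) - u (L - e, p)) / e @[e --> 0^'+] --> sigma * u (L, p)).

Definition steklov_eigenspace (R : realType) (n : nat)
    (Sigma : riemannian_manifold R n) (L : R) (h : R -> R) (sigma : R) :
    set (R * Sigma -> R) :=
  [set u : R * Sigma -> R | [/\ smooth_on_warped L u, harmonic_on_warped L h u
             & steklov_boundary_condition L sigma u]].

Definition steklov_spectrum (R : realType) (n : nat)
    (Sigma : riemannian_manifold R n) (L : R) (h : R -> R) (sigma : nat -> R) :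
    Prop :=
  is_spectrum (@warped_carrier R Sigma L) (@steklov_eigenspace R n Sigma L h) sigma.

Definition borel (T : ptopologicalType) := g_sigma_algebraType (@open T).

Definition row2 (R : realType) (a : R * R) : 'rV[R]_2 :=
  \row_(k < 2) (if k == 0 then a.1 else a.2).

(* The Borel measure vol is the Riemannian area of Sigma: on subsets of a chart
   domain it is the integral of sqrt(det g) dx_1 dx_2. As the chart domains
   cover Sigma, this determines vol. *)
Definition is_riemannian_area (R : realType) (Sigma : riemannian_manifold R 2)
    (vol : {measure set (borel Sigma) -> \bar R}) : Prop :=
  forall (i : chart_index Sigma) (A : set (borel Sigma)), measurable A -> A `<=` chart_dom i ->
    vol A =
    (\int[lebesgue_measure \x lebesgue_measure]_(a in
        [set a : R * R | chart_img i (row2 a) /\ A (chart_inv i (row2 a))])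
      (Num.sqrt (\det (metric i (row2 a))))%:E)%E.

Definition has_area (R : realType) (Sigma : riemannian_manifold R 2) (a : \bar R) :
    Prop :=
  exists vol : {measure set (borel Sigma) -> \bar R},
    is_riemannian_area vol /\ vol setT = a.

(* Main.v *)
Require Import Defs.
From HB Require Import structures.
From mathcomp Require Import all_boot all_order all_algebra.
From mathcomp Require Import all_classical all_reals all_analysis.
From mathcomp Require Import ring lra.

(* Separate variables: if [phi] is an eigenfunction of Sigma for [mu], then
   [u(t) phi(x)] is harmonic as soon as [(h^2 u')' = mu u]; in dimension 2 no power
   of [h] multiplies [mu]. For each [mu >= 0] this equation has a solution [u > 0]
   on [0, L] with [u(0) = 1] satisfying the Steklov condition for some [s(mu)], and
   [w = h^2 u' / u] solves the Riccati equation [w' = mu - w^2 / h^2] with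
   [w(0) = - s(mu)] and [w(L) = s(mu)], so [2 s(mu) <= L mu], strictly if [mu > 0].
   The map [mu |-> s(mu)] is injective and [phi |-> u phi] is injective from the
   eigenspace of [mu] to the Steklov eigenspace of [s(mu)]; counting with
   multiplicity, at least [j + 1] Steklov eigenvalues are less than
   [L lambda_j / 2]. *)

Set Implicit Arguments.
Unset Strict Implicit.
Unset Printing Implicit Defensive.

Import Order.TTheory GRing.Theory Num.Theory.
Import numFieldNormedType.Exports.

Local Open Scope classical_set_scope.
Local Open Scope ring_scope.

(** * Calculus on the real line *)

Section RealCalculus.
Context {R : realType}.
Implicit Types (f g : R -> R) (x y a b : R).

(** No variational characterization of Steklov eigenvalues is used: [is_spectrum] identifies
    multiplicities with dimensions of eigenspaces, so explicit eigenfunctions and a pigeonhole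
    argument suffice. The count requires [s(mu)] to be injective, and this, like the division in the
    Riccati equation, rests on [u > 0]. Positivity comes from the choice of [s]. With [p = h^-2] and
    [v = h^2 u'] the equation is the system [u' = p v], [v' = mu u]; since [h = 1] at both ends, the
    Steklov conditions are [v(0) = - s] and [v(L) = s u(L)]. They leave a quadratic equation for
    [s], whose smaller root lies below every value of [s] for which [u] has a zero on [[0, L]]. The
    other obstacle is regularity up to the boundary: eigenfunctions must locally be restrictions of
    smooth functions on open sets, also at [t = 0] and [t = L]. Hence [h] is extended past [[0, L]]
    and [p] to the whole line, where a linear system with bounded continuous coefficients has a
    global solution, given by its Picard series; smoothness near [[0, L]] is then read off the
    system. *)

Lemma is_derive_mul f g x (df dg : R) :
  is_derive x 1 f df -> is_derive x 1 g dg ->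
  is_derive x 1 (fun t => f t * g t) (df * g x + f x * dg).
Proof.
move=> Hf Hg; have H := is_deriveM Hf Hg.
by apply: is_derive_eq; rewrite /= addrC [g x *: _]mulrC.
Qed.

Lemma is_derive_lin f g x a b (df dg : R) :
  is_derive x 1 f df -> is_derive x 1 g dg ->
  is_derive x 1 (fun t => a * f t + b * g t) (a * df + b * dg).
Proof.
move=> Hf Hg.
exact: (is_deriveD (is_deriveZ a Hf) (is_deriveZ b Hg)).
Qed.

Lemma is_derive_continuous f x (df : R) :
  is_derive x 1 f df -> {for x, continuous f}.
Proof. by case=> Hf _; apply/differentiable_continuous/derivable1_diffP. Qed.

Lemma within_is_derive f (df : R -> R) a b :
  (forall t, a <= t <= b -> is_derive t 1 f (df t)) -> {within `[a, b], continuous f}.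
Proof.
move=> Hf; apply: derivable_within_continuous => t /[!in_itv]/= tab.
by have [] := Hf t tab.
Qed.

Lemma is_derive_MVT f (df : R -> R) a b : a < b ->
  (forall t, a <= t <= b -> is_derive t 1 f (df t)) ->
  exists2 c, a < c < b & f b - f a = df c * (b - a).
Proof.
move=> ab Hf; have [t|c] := @MVT R f df a b ab _ (within_is_derive Hf).
  by rewrite in_itv/= => /andP[ta tb]; apply: Hf; rewrite !ltW.
by rewrite in_itv/= => cab E; exists c.
Qed.

Lemma is_derive_ge0_le f (df : R -> R) a b : a <= b ->
  (forall t, a <= t <= b -> is_derive t 1 f (df t)) ->
  (forall t, a <= t <= b -> 0 <= df t) -> f a <= f b.
Proof.
rewrite le_eqVlt => /orP[/eqP -> //|ab] Hf df0.
have [c /andP[ac cb] E] := is_derive_MVT ab Hf.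
by rewrite -subr_ge0 E mulr_ge0 ?subr_ge0 ?df0 ?ltW.
Qed.

Lemma is_derive_gt0_lt f (df : R -> R) a b : a < b ->
  (forall t, a <= t <= b -> is_derive t 1 f (df t)) ->
  (forall t, a < t < b -> 0 < df t) -> f a < f b.
Proof.
move=> ab Hf df0.
have [c cab E] := is_derive_MVT ab Hf.
by rewrite -subr_gt0 E mulr_gt0 ?subr_gt0 ?df0.
Qed.

Lemma is_derive_0_eq f a b :
  (forall t, Num.min a b <= t <= Num.max a b -> is_derive t 1 f 0) -> f a = f b.
Proof.
suff le_case x y : x <= y -> (forall t, x <= t <= y -> is_derive t 1 f 0) -> f x = f y.
  by have [ab|/ltW ab] := leP a b => Hf; [|apply/esym]; apply: le_case.
move=> {a b} ab Hf; apply/le_anti/andP; split.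
  exact: is_derive_ge0_le ab Hf _.
rewrite -lerN2.
apply: (@is_derive_ge0_le (fun t => - f t) (fun=> 0) x y ab) => // t tab.
by rewrite -oppr0; apply: is_deriveN; apply: Hf.
Qed.

(** The integral from [- N] is differentiable only to the right of its base point; subtracting its
    value at 0 makes the primitives for different [N] agree where both are defined. *)
Lemma primitive_on_halfline f (N : R) : 0 < N -> continuous f ->
  exists F : R -> R, F 0 = 0 /\ forall t : R, - N < t -> is_derive t 1 F (f t).
Proof.
move=> N0 cf; set mu := @lebesgue_measure R.
pose G t := (\int[mu]_(s in `[- N, t]) f s)%R.
exists (fun t => G t - G 0); split; first by rewrite subrr.
move=> t Nt.
have fi : mu.-integrable `[- N, t + 1] (EFin \o f).
  apply: continuous_compact_integrable; first exact: segment_compact.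
  exact: continuous_subspaceT.
have [|dG DG] := @continuous_FTC1_closed R f (- N) t (t + 1) _ fi Nt (cf t).
  by rewrite ltrDl.
have HG : is_derive t 1 G (f t) by apply: DeriveDef; [exact: dG|rewrite -DG derive1E].
rewrite -[f t]subr0.
by apply: is_deriveB.
Qed.

Lemma continuous_has_primitive f : continuous f ->
  exists F : R -> R, F 0 = 0 /\ forall t : R, is_derive t 1 F (f t).
Proof.
move=> cf.
have /choice[G HG] : forall N : R, exists F : R -> R,
    0 < N -> F 0 = 0 /\ forall t : R, - N < t -> is_derive t 1 F (f t).
  move=> N; have [N0|N0] := ltP 0 N; last by exists f.
  by have [F HF] := primitive_on_halfline N0 cf; exists F.
have agree N M t : 0 < N -> 0 < M -> - N < t -> - M < t -> G N t = G M t.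
  move=> N0 M0 Nt Mt; have [GN dN] := HG N N0; have [GM dM] := HG M M0.
  have E : G N t - G M t = G N 0 - G M 0.
    apply: (@is_derive_0_eq (fun t => G N t - G M t)) => s /andP[s1 _].
    rewrite -(subrr (f s)); apply: is_deriveB.
      by apply: dN; apply: lt_le_trans s1; rewrite lt_min Nt oppr_lt0.
    by apply: dM; apply: lt_le_trans s1; rewrite lt_min Mt oppr_lt0.
  by apply/eqP; rewrite -subr_eq0 E GN GM subrr.
(* The half-line varies with [t]. Near a given [t] this function coincides with the primitive for
   the fixed value [|t| + 2], so it inherits the derivative of that primitive. *)
exists (fun t => G (`|t| + 1) t); split.
  by apply: (proj1 (HG (`|0| + 1) _)); rewrite normr0 add0r.
move=> t.
have N0 : 0 < `|t| + 2 by rewrite ltr_wpDl.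
have Nt : - (`|t| + 2) < t.
  by rewrite ltrNl; apply: le_lt_trans (ler_norm _) _; rewrite normrN ltrDl.
apply: near_eq_is_derive (proj2 (HG _ N0) t Nt).
near=> s.
have s0 : 0 < `|s| + 1 by rewrite ltr_wpDl.
apply: agree => //; first by near: s; apply: lt_nbhsr.
by rewrite ltrNl; apply: le_lt_trans (ler_norm _) _; rewrite normrN ltrDl.
Unshelve. all: by end_near. Qed.

(* Weight for the Picard iteration: on both sides of 0 it dominates [K] times the
   modulus of its primitive vanishing at 0, so integrating gains a factor [1 / K]. *)
Definition cosh_weight (K t : R) : R := expR (K * t) + expR (- K * t).

Lemma is_derive_expR_scale (K t : R) :
  is_derive t 1 (fun s => expR (K * s)) (K * expR (K * t)).
Proof.
have H : is_derive t 1 (fun s : R => K * s) K.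
  by rewrite -[X in is_derive _ _ _ X]mulr1; apply: (is_deriveZ K (is_derive_id t 1)).
rewrite mulrC; exact: is_derive1_comp.
Qed.

Lemma is_derive_sinh_weight (K t : R) : K != 0 ->
  is_derive t 1 (fun s => (expR (K * s) - expR (- K * s)) / K) (cosh_weight K t).
Proof.
move=> K0; have := is_derive_lin K^-1 (- K^-1) (is_derive_expR_scale K t)
  (is_derive_expR_scale (- K) t).
congr is_derive; first by apply/funext => s; rewrite /= mulrC mulrBl mulNr mulrC (mulrC _ K^-1).
by rewrite /cosh_weight; field.
Qed.

Lemma cosh_weight_gt0 (K t : R) : 0 < cosh_weight K t.
Proof. by rewrite addr_gt0 ?expR_gt0. Qed.

(** A mean value inequality: with [S] the primitive of the weight, both [M * S + f] and [M * S - f]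
    are nondecreasing. *)
Lemma lipschitz_cosh_weight f (df : R -> R) (K M : R) : K != 0 ->
  (forall t : R, is_derive t 1 f (df t)) ->
  (forall t, `|df t| <= M * cosh_weight K t) ->
  forall s t, `|f t - f s| <=
     M * `|(expR (K * t) - expR (- K * t)) / K - (expR (K * s) - expR (- K * s)) / K|.
Proof.
move=> K0 Hf Hdf s t; set S := fun t => (expR (K * t) - expR (- K * t)) / K.
wlog st : s t / s <= t => [H|].
  have [/H//|/ltW/H] := leP s t.
  by rewrite distrC [in X in _ <= X -> _]distrC.
have HS (r : R) : is_derive r 1 S (cosh_weight K r) by exact: is_derive_sinh_weight.
have S_le : S s <= S t.
  by apply: (is_derive_ge0_le st (fun r _ => HS r)) => r _; exact/ltW/cosh_weight_gt0.
have L1 : M * S s + 1 * f s <= M * S t + 1 * f t.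
  apply: (is_derive_ge0_le st (fun r _ => is_derive_lin M 1 (HS r) (Hf r))) => r _.
  by have := Hdf r; rewrite ler_norml => /andP[? _]; lra.
have L2 : M * S s + (-1) * f s <= M * S t + (-1) * f t.
  apply: (is_derive_ge0_le st (fun r _ => is_derive_lin M (-1) (HS r) (Hf r))) => r _.
  by have := Hdf r; rewrite ler_norml => /andP[_ ?]; lra.
rewrite -/(S t) -/(S s) (ger0_norm (x := S t - S s)) ?subr_ge0 // ler_norml.
by apply/andP; split; lra.
Qed.

(** The previous estimate from the base point 0, combined with
    [|exp x - exp (- x)| <= exp x + exp (- x)], which covers both signs of [t] at once. *)
Lemma cosh_weight_bound f (df : R -> R) (K M : R) : 0 < K ->
  f 0 = 0 -> (forall t : R, is_derive t 1 f (df t)) ->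
  (forall t, `|df t| <= M * cosh_weight K t) ->
  forall t, `|f t| <= M / K * cosh_weight K t.
Proof.
move=> K0 f0 Hf Hdf t.
have M0 : 0 <= M.
  by rewrite -(pmulr_lge0 _ (cosh_weight_gt0 K 0)) (le_trans _ (Hdf 0)).
have := lipschitz_cosh_weight (lt0r_neq0 K0) Hf Hdf 0 t.
rewrite f0 subr0 !mulr0 subrr mul0r subr0 => /le_trans; apply.
rewrite -mulrA ler_wpM2l // normrM [`|K^-1|]gtr0_norm ?invr_gt0 // mulrC.
apply: ler_wpM2l; first by rewrite invr_ge0 ltW.
by apply: le_trans (ler_normB _ _) _; rewrite !ger0_norm ?expR_ge0.
Qed.

End RealCalculus.

(** * Existence for linear systems of two equations *)

Section LinearSystem.
Context {R : realType}.
Implicit Types (f g : nat -> R -> R) (p q u v : R -> R) (t s : R).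

Lemma geometric_series_tail (a : nat -> R) (D : R) :
  (forall k, `|a k| <= D / 2 ^+ k) ->
  exists l, forall n, `|l - \sum_(k < n) a k| <= 2 * D / 2 ^+ n.
Proof.
move=> aD; have D0 : 0 <= D by have := aD 0%N; rewrite expr0 divr1; apply: le_trans.
(* The subtracted term is what lets the induction on [m] close. *)
have tail n m : `|\sum_(k < n + m) a k - \sum_(k < n) a k| <=
    2 * D / 2 ^+ n - 2 * D / 2 ^+ (n + m).
  elim: m => [|m IH]; first by rewrite addn0 !subrr normr0.
  rewrite addnS big_ord_recr /= addrAC (le_trans (ler_normD _ _)) //.
  apply: le_trans (lerD IH (aD _)) _; rewrite exprS.
  have : 2 ^+ (n + m) != 0 :> R by rewrite expf_neq0.
  move: (2 ^+ (n + m)) => z z0.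
  suff -> : 2 * D / (2 * z) = 2 * D / z - D / z by lra.
  by field.
have cv : cvgn (series a).
  apply: normed_cvg; apply: (@series_le_cvg _ _ (geometric D 2^-1)) => [n|n|n|].
  - exact: normr_ge0.
  - by rewrite geometric_ge0 // invr_ge0.
  - by rewrite /= exprVn.
  - by apply: is_cvg_geometric_series; rewrite ger0_norm // invf_lt1 // ltr1n.
exists (limn (series a)) => n.
have cvn : `|series a m - \sum_(k < n) a k| @[m --> \oo] -->
    `|limn (series a) - \sum_(k < n) a k|.
  by apply: cvg_norm; apply: cvgB => //; apply: cvg_cst.
apply: (ler_cvg_to cvn (cvg_cst (2 * D / 2 ^+ n))).
exists n => // m /= nm; rewrite /series /= big_mkord -(subnKC nm).
apply: le_trans (tail _ _) _; rewrite gerBl divr_ge0 ?mulr_ge0 ?exprn_ge0 //.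
Qed.

Lemma eq_of_geometric_bound (x y M : R) :
  (forall n, `|x - y| <= M / 2 ^+ n) -> x = y.
Proof.
move=> H; apply/eqP; rewrite -subr_eq0 -normr_le0.
have c0 : geometric M 2^-1 @ \oo --> (0 : R).
  by apply: cvg_geometric; rewrite ger0_norm // invf_lt1 // ltr1n.
apply: (ler_cvg_to (cvg_cst `|x - y|) c0).
by apply: nearW => n; rewrite /= exprVn.
Qed.

Lemma norm_sum_geometric (a : nat -> R) (D : R) n :
  (forall k, `|a k| <= D / 2 ^+ k) -> `|\sum_(k < n) a k| <= 2 * D.
Proof.
move=> aD; have D0 : 0 <= D by have := aD 0%N; rewrite expr0 divr1; apply: le_trans.
suff : `|\sum_(k < n) a k| <= 2 * D - 2 * D / 2 ^+ n.
  by move=> /le_trans; apply; rewrite gerBl divr_ge0 ?mulr_ge0 ?exprn_ge0.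
elim: n => [|n IH]; first by rewrite big_ord0 normr0 expr0 divr1 subrr.
rewrite big_ord_recr /= (le_trans (ler_normD _ _)) //.
apply: le_trans (lerD IH (aD _)) _; rewrite exprS.
have : 2 ^+ n != 0 :> R by rewrite expf_neq0.
move: (2 ^+ n) => z z0.
suff -> : 2 * D / (2 * z) = 2 * D / z - D / z by lra.
by field.
Qed.

Lemma is_derive_sum_ord f (df : nat -> R -> R) n t :
  (forall k, is_derive t 1 (f k) (df k t)) ->
  is_derive t 1 (fun s => \sum_(k < n) f k s) (\sum_(k < n) df k t).
Proof.
move=> Hf; elim: n => [|n IH].
  rewrite big_ord0 (_ : (fun s => _) = cst 0); last by apply/funext => s; rewrite big_ord0.
  exact: is_derive_cst.
rewrite big_ord_recr (_ : (fun s => _) = (fun s => \sum_(k < n) f k s) + f n).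
  exact: is_deriveD.
by apply/funext => s; rewrite big_ord_recr.
Qed.

(** * The limit of the Picard series, one component at a time *)

Section PicardLimit.
Variables (f g : nat -> R -> R) (p : R -> R) (B C K al : R) (F G : R -> R).
Hypotheses (B0 : 0 <= B) (K0 : 0 < K).
Hypothesis pB : forall t, `|p t| <= B.
Hypothesis f0 : f 0%N = cst al.
Hypothesis fS : forall n t, is_derive t 1 (f n.+1) (p t * g n t).
Hypothesis fS0 : forall n, f n.+1 0 = 0.
Hypothesis gC : forall n t, `|g n t| <= C * cosh_weight K t / 2 ^+ n.
Hypothesis FE : forall n t,
  `|F t - \sum_(k < n) f k t| <= 2 * (C * cosh_weight K t) / 2 ^+ n.
Hypothesis GE : forall n t,
  `|G t - \sum_(k < n) g k t| <= 2 * (C * cosh_weight K t) / 2 ^+ n.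

(** The index shifts by one because the term [f 0] is constant. *)
Let partial_derive n t : is_derive t 1 (fun s => \sum_(k < n.+1) f k s)
  (p t * \sum_(k < n) g k t).
Proof.
rewrite (_ : (fun s => _) = cst al + (fun s => \sum_(k < n) f k.+1 s)); last first.
  by apply/funext => s; rewrite big_ord_recl f0.
rewrite -[p t * _]add0r mulr_sumr; apply: is_deriveD.
exact: (@is_derive_sum_ord (fun k => f k.+1) (fun k s => p s * g k s) n t (fS^~ t)).
Qed.

(** The partial sums are Lipschitz with respect to the primitive [S] of the weight, with the
    constant [B * (2 * C)] independent of [n], and this estimate passes to the limit. *)
Lemma picard_limit_continuous : continuous F.
Proof.
move=> s; pose S := fun t => (expR (K * t) - expR (- K * t)) / K.
have cS : {for s, continuous S}.
  exact: is_derive_continuous (is_derive_sinh_weight s (lt0r_neq0 K0)).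
pose M := B * (2 * C).
have lip t : `|F t - F s| <= M * `|S t - S s|.
  have cF r : (\sum_(k < n.+1) f k r) @[n --> \oo] --> F r.
    apply/cvgrPdist_le => e e0.
    have c0 : geometric (2 * (C * cosh_weight K r)) 2^-1 @ \oo --> (0 : R).
      by apply: cvg_geometric; rewrite ger0_norm // invf_lt1 // ltr1n.
    have /cvgrPdist_le/(_ e e0) := c0.
    move=> [N _ HN]; exists N => // n /= Nn; apply: le_trans (FE _ _) _.
    have := HN n.+1 (leqW Nn); rewrite sub0r normrN /= exprVn.
    exact: le_trans (ler_norm _).
  have cFF : `|\sum_(k < n.+1) f k t - \sum_(k < n.+1) f k s| @[n --> \oo]
      --> `|F t - F s| by apply: cvg_norm; apply: cvgB.
  apply: (ler_cvg_to cFF (cvg_cst (M * `|S t - S s|))).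
  apply: nearW => n.
  apply: (lipschitz_cosh_weight (lt0r_neq0 K0) (partial_derive n)) => r.
  rewrite normrM /M -mulrA ler_pM //.
  by have := norm_sum_geometric n (gC^~ r); rewrite mulrA.
apply/cvgrPdist_le => e e0.
have M0 : 0 < `|M| + 1 by rewrite ltr_wpDl.
have /cvgrPdist_le/(_ (e / (`|M| + 1)))/(_ (divr_gt0 e0 M0)) := cS.
apply: filterS => t Ht; rewrite distrC; apply: le_trans (lip t) _.
apply: le_trans (_ : (`|M| + 1) * (e / (`|M| + 1)) <= _); last first.
  by rewrite mulrC divfK ?lt0r_neq0.
apply: le_trans (_ : (`|M| + 1) * `|S t - S s| <= _).
  by rewrite ler_wpM2r // (le_trans (ler_norm _)) // lerDl.
by rewrite ler_pM2l // distrC.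
Qed.

(** Differentiation under the limit is avoided: [F] is identified with [al] plus a primitive [P] of
    [p * G], by comparing both with the same partial sum. *)
Lemma picard_limit_derive : continuous p -> continuous G ->
  F 0 = al /\ forall t, is_derive t 1 F (p t * G t).
Proof.
move=> cp cG.
have cpG : continuous (fun t => p t * G t).
  by move=> t; apply: cvgM; [exact: cp|exact: cG].
have [P [P0 dP]] := continuous_has_primitive cpG.
suff FP : F = cst al + P.
  split; first by rewrite FP /= /GRing.add /= P0 addr0.
  by move=> t; rewrite FP -[_ * _]add0r; apply: is_deriveD.
apply/funext => t.
(* The first summand bounds the distance from [F] to the partial sum of [n + 1] terms; the second
   bounds the distance from that sum to [al + P], obtained by integrating the error of [n] terms of
   [g]. *)
apply: (@eq_of_geometric_bound _ _ (C * cosh_weight K t + B * (2 * C) / K * cosh_weight K t)).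
move=> n.
have dn (r : R) : is_derive r 1 (fun s => \sum_(k < n.+1) f k s - (cst al + P) s)
    (p r * \sum_(k < n) g k r - p r * G r).
  apply: is_deriveB (partial_derive n r) _.
  by rewrite -[_ * _]add0r; apply: is_deriveD.
have d0 : \sum_(k < n.+1) f k 0 - (cst al + P) 0 = 0.
  rewrite big_ord_recl f0 big1 => [|k _]; last exact: fS0.
  by rewrite [X in _ - X]/GRing.add /= P0 !addr0 subrr.
have := cosh_weight_bound (M := B * (2 * C) / 2 ^+ n) K0 d0 dn.
move=> /(_ _ t) H; rewrite mulrDl.
have {}H := H _.
apply: le_trans (_ : `|F t - \sum_(k < n.+1) f k t| + _ <= _).
  have -> : F t - (cst al + P) t = (F t - \sum_(k < n.+1) f k t) +
      (\sum_(k < n.+1) f k t - (cst al + P) t) by rewrite addrA subrK.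
  exact: ler_normD.
apply: lerD.
  apply: le_trans (FE _ _) _; rewrite exprS.
  have z0 : 2 ^+ n != 0 :> R by rewrite expf_neq0.
  by rewrite le_eqVlt; apply/orP; left; apply/eqP; field.
apply: le_trans (H _) _.
  move=> r; rewrite -mulrBr normrM distrC.
  apply: le_trans (ler_pM _ _ (pB r) (GE n r)) _ => //.
  by rewrite !mulrA le_eqVlt; apply/orP; left; apply/eqP; ring.
by rewrite le_eqVlt; apply/orP; left; apply/eqP; ring.
Qed.

End PicardLimit.

Lemma cosh_weight_ge1 (K t : R) : 1 <= cosh_weight K t.
Proof.
rewrite /cosh_weight mulNr.
have [x0|x0] := leP 0 (K * t).
  by rewrite -[1]addr0 lerD ?expR_ge0 // -[1]expR0 ler_expR.
by rewrite -[1]add0r lerD ?expR_ge0 // -[1]expR0 ler_expR oppr_ge0 ltW.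
Qed.

Lemma linear_system_solution (p q : R -> R) (B al be : R) :
  continuous p -> continuous q ->
  (forall t, `|p t| <= B) -> (forall t, `|q t| <= B) ->
  exists u v, [/\ u 0 = al, v 0 = be,
    forall t, is_derive t 1 u (p t * v t) & forall t, is_derive t 1 v (q t * u t)].
Proof.
move=> cp cq pB qB.
have B0 : 0 <= B by have := pB 0; apply: le_trans.
have /choice[prim Hprim] : forall f : R -> R, exists F : R -> R,
    continuous f -> F 0 = 0 /\ forall t : R, is_derive t 1 F (f t).
  move=> f; have [cf|ncf] := pselect (continuous f); last by exists f.
  by have [F HF] := continuous_has_primitive cf; exists F.
pose step (w : (R -> R) * (R -> R)) :=
  (prim (fun t => p t * w.2 t), prim (fun t => q t * w.1 t)).
(* As [step] is linear and its values vanish at 0, [w n] is the increment between successive Picard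
   iterates; the solution is the sum of all the [w n]. *)
pose w n := iter n step (cst al, cst be).
have cw n : continuous (w n).1 /\ continuous (w n).2.
  elim: n => [|n [c1 c2]]; first by split=> t; apply: cvg_cst.
  split=> t; apply: is_derive_continuous.
  - by apply: (Hprim _ _).2 => r; apply: cvgM; [exact: cp|exact: c2].
  - by apply: (Hprim _ _).2 => r; apply: cvgM; [exact: cq|exact: c1].
have dw1 n : (w n.+1).1 0 = 0 /\ forall t, is_derive t 1 (w n.+1).1 (p t * (w n).2 t).
  by apply: Hprim => r; apply: cvgM; [exact: cp|exact: (cw n).2].
have dw2 n : (w n.+1).2 0 = 0 /\ forall t, is_derive t 1 (w n.+1).2 (q t * (w n).1 t).
  by apply: Hprim => r; apply: cvgM; [exact: cq|exact: (cw n).1].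
(* With this [K] each integration gains a factor 1/2; the added 1 keeps [K] positive when [B = 0].
   The constant [C] dominates both initial values. *)
pose K := 2 * (B + 1); pose C := `|al| + `|be|.
have K0 : 0 < K by rewrite mulr_gt0 // ltr_wpDl.
have C0 : 0 <= C by rewrite addr_ge0.
have bw n : (forall t, `|(w n).1 t| <= C * cosh_weight K t / 2 ^+ n) /\
            (forall t, `|(w n).2 t| <= C * cosh_weight K t / 2 ^+ n).
  elim: n => [|n [b1 b2]].
    split=> t; rewrite expr0 divr1 -[X in X <= _]mulr1;
    by apply: ler_pM => //; rewrite ?cosh_weight_ge1 // ?lerDl ?lerDr.
  have half (F df r : R -> R) : F 0 = 0 -> (forall t, `|r t| <= B) ->
      (forall t, is_derive t 1 F (r t * df t)) ->
      (forall t, `|df t| <= C * cosh_weight K t / 2 ^+ n) ->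
      forall t, `|F t| <= C * cosh_weight K t / 2 ^+ n.+1.
    move=> F0 rB dF bd t.
    have := cosh_weight_bound (M := (B + 1) * (C / 2 ^+ n)) K0 F0 dF.
    move=> /(_ _ t) H; apply: le_trans (H _) _.
      move=> s; rewrite normrM; apply: le_trans (ler_pM _ _ (rB s) (bd s)) _ => //.
      rewrite [X in B * X]mulrAC mulrA ler_wpM2r ?(ltW (cosh_weight_gt0 _ _)) //.
      by rewrite ler_wpM2r ?divr_ge0 ?exprn_ge0 // lerDl.
    rewrite le_eqVlt; apply/orP; left; apply/eqP; rewrite /K exprS.
    have z0 : 2 ^+ n != 0 :> R by rewrite expf_neq0.
    by field; rewrite z0 /= gt_eqF // ltr_wpDl.
  split.
    exact: half (dw1 n).1 pB (dw1 n).2 b2.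
  exact: half (dw2 n).1 qB (dw2 n).2 b1.
have /choice[F FE] : forall t, exists l, forall n,
    `|l - \sum_(k < n) (w k).1 t| <= 2 * (C * cosh_weight K t) / 2 ^+ n.
  by move=> t; apply: (@geometric_series_tail (fun k => (w k).1 t)) => k; apply: (bw k).1.
have /choice[G GE] : forall t, exists l, forall n,
    `|l - \sum_(k < n) (w k).2 t| <= 2 * (C * cosh_weight K t) / 2 ^+ n.
  by move=> t; apply: (@geometric_series_tail (fun k => (w k).2 t)) => k; apply: (bw k).2.
pose f n := (w n).1; pose g n := (w n).2.
have cF : continuous F.
  apply: (@picard_limit_continuous f g p B C K al F) => //.
  - by move=> n; exact: (dw1 n).2.
  - by move=> n; exact: (bw n).2.
have cG : continuous G.
  apply: (@picard_limit_continuous g f q B C K be G) => //.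
  - by move=> n; exact: (dw2 n).2.
  - by move=> n; exact: (bw n).1.
have [F0 dF] : F 0 = al /\ forall t, is_derive t 1 F (p t * G t).
  apply: (@picard_limit_derive f g p B C K al F G) => //.
  - by move=> n; exact: (dw1 n).2.
  - by move=> n; exact: (dw1 n).1.
have [G0 dG] : G 0 = be /\ forall t, is_derive t 1 G (q t * F t).
  apply: (@picard_limit_derive g f q B C K be G F) => //.
  - by move=> n; exact: (dw2 n).2.
  - by move=> n; exact: (dw2 n).1.
by exists F, G; split; [exact: F0|exact: G0|exact: dF|exact: dG].
Qed.

End LinearSystem.

(** * The radial Steklov problem *)

Section SteklovMode.
Context {R : realType}.
Implicit Types (p u v : R -> R) (t s mu L : R).

Lemma is_derive_div (f g : R -> R) (x df dg : R) : g x != 0 ->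
  is_derive x 1 f df -> is_derive x 1 g dg ->
  is_derive x 1 (fun t => f t / g t) ((df * g x - f x * dg) / g x ^+ 2).
Proof.
move=> gx Hf Hg.
have HV : is_derive x 1 (fun t => (g t)^-1) (- (g x) ^- 2 * dg).
  have [dG DG] := Hg; apply: DeriveDef; first exact: derivableV.
  by rewrite deriveV // DG.
have := is_derive_mul Hf HV.
by congr is_derive; field.
Qed.

Lemma nonvanishing_gt0 (f : R -> R) L : 0 <= L ->
  {within `[0, L], continuous f} -> 0 < f 0 ->
  (forall t, 0 <= t <= L -> f t != 0) -> forall t, 0 <= t <= L -> 0 < f t.
Proof.
move=> L0 cf f0 nz t /andP[t0 tL]; rewrite ltNge; apply/negP => ft.
have cf' : {within `[0, t], continuous f}.
  by apply: continuous_subspaceW cf; apply: subset_itvl; rewrite bnd_simp.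
have [|c] := @IVT R f 0 t 0 t0 cf'.
  by rewrite ge_min le_max ft (ltW f0) orbT.
rewrite in_itv/= => /andP[c0 ct] fc.
by have := nz c; rewrite fc eqxx c0 (le_trans ct tL) => /(_ isT).
Qed.

(** First-order form of [(h^2 u')' = mu u] for [p = h^-2] and [v = h^2 u'], in which no coefficient
    is differentiated. It is imposed on the whole line, so that [u] is available beyond the ends of
    [[0, L]]. *)
Definition radial_solution p mu u v : Prop :=
  (forall t, is_derive t 1 u (p t * v t)) /\ (forall t, is_derive t 1 v (mu * u t)).

(* [u] is the radial factor of the Steklov eigenfunction with eigenvalue [s]
   attached to the eigenvalue [mu] of Sigma, and [v] is [u' / p]. *)
Record steklov_mode p L mu s u v : Prop := SteklovMode {
  mode_solution : radial_solution p mu u v ;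
  mode_u0 : u 0 = 1 ;
  mode_v0 : v 0 = - s ;
  mode_vL : v L = s * u L ;
  mode_gt0 : forall t, 0 <= t <= L -> 0 < u t }.

Lemma wronskian_constant p mu u1 v1 u2 v2 t :
  radial_solution p mu u1 v1 -> radial_solution p mu u2 v2 ->
  u1 t * v2 t - u2 t * v1 t = u1 0 * v2 0 - u2 0 * v1 0.
Proof.
move=> [du1 dv1] [du2 dv2].
apply: (@is_derive_0_eq _ (fun r => u1 r * v2 r - u2 r * v1 r)) => r _.
have := is_deriveB (is_derive_mul (du1 r) (dv2 r)) (is_derive_mul (du2 r) (dv1 r)).
by congr is_derive; ring.
Qed.

Lemma radial_solution_lin p mu u1 v1 u2 v2 (a b : R) :
  radial_solution p mu u1 v1 -> radial_solution p mu u2 v2 ->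
  radial_solution p mu (fun t => a * u1 t + b * u2 t) (fun t => a * v1 t + b * v2 t).
Proof.
move=> [du1 dv1] [du2 dv2]; split=> t.
  by have := is_derive_lin a b (du1 t) (du2 t); congr is_derive; ring.
by have := is_derive_lin a b (dv1 t) (dv2 t); congr is_derive; ring.
Qed.

(** Since [(u v)' = p v^2 + mu u^2] is nonnegative, [u v >= 0] to the right of 0; hence
    [(v^2)' = 2 mu u v >= 0] and [v^2 >= 1], which makes [(u v)'] strictly positive. *)
Lemma radial_solution_from_zero p mu u v : (forall t, 0 < p t) -> 0 <= mu ->
  radial_solution p mu u v -> u 0 = 0 -> v 0 = 1 -> forall t, 0 < t -> u t != 0.
Proof.
move=> p0 mu0 [du dv] u0 v0 t t0.
have duv (r : R) := is_derive_mul (du r) (dv r).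
have uv_ge0 r : 0 <= r -> 0 <= u r * v r.
  move=> r0; rewrite -[X in X <= _](mul0r (v 0)) -[X in X * v 0]u0.
  apply: (is_derive_ge0_le r0 (fun z _ => duv z)) => z _.
  rewrite (_ : _ + _ = p z * v z ^+ 2 + mu * u z ^+ 2); last by ring.
  by rewrite addr_ge0 // mulr_ge0 ?sqr_ge0 // ltW.
have dvv (r : R) := is_derive_mul (dv r) (dv r).
have vv_ge1 r : 0 <= r -> 1 <= v r * v r.
  move=> r0; rewrite -[X in X <= _](mulr1 1) -v0.
  apply: (is_derive_ge0_le r0 (fun z _ => dvv z)) => z /andP[z0 _].
  have := mulr_ge0 mu0 (uv_ge0 z z0); lra.
have : 0 < u t * v t.
  rewrite -[X in X < _](mul0r (v 0)) -[X in X * v 0]u0.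
  apply: (is_derive_gt0_lt t0 (fun z _ => duv z)) => z /andP[z0 _].
  rewrite (_ : _ + _ = p z * (v z * v z) + mu * u z ^+ 2); last by ring.
  apply: ltr_pwDl; last by apply: mulr_ge0 => //; apply: sqr_ge0.
  by rewrite mulr_gt0 // (lt_le_trans _ (vv_ge1 z (ltW z0))).
by move=> uv0; apply/eqP => u_0; move: uv0; rewrite u_0 mul0r ltxx.
Qed.

(* The smaller root of the quadratic equation [v1 - s v2 = s (u1 - s u2)] lies
   below [u1 / u2] because the quadratic takes the value [- 1 / u2] there. *)
Lemma steklov_quadratic_root (a b d D : R) : D != 0 -> a * d - D * b = 1 ->
  (* The equation is [D s^2 - (a + d) s + b = 0], and [a d - D b = 1] turns its discriminant into
     [(d - a)^2 + 4]. So [a / D + x] is the midpoint of the roots and [e] half their distance. *)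
  exists s, s < a / D /\ b - s * d = s * (a - s * D).
Proof.
move=> D0 W; pose x := (d - a) / (2 * D); pose e := Num.sqrt (x ^+ 2 + D ^- 2).
have D2 : 0 < D ^- 2 by rewrite invr_gt0 exprn_even_gt0.
have xe : x < e.
  apply: le_lt_trans (ler_norm x) _; rewrite -sqrtr_sqr ltr_sqrt ?ltrDl //.
  by rewrite ltr_wpDl ?sqr_ge0.
have e2 : e ^+ 2 = x ^+ 2 + D ^- 2 by rewrite sqr_sqrtr // addr_ge0 ?sqr_ge0 ?ltW.
exists (a / D + (x - e)); split; first by rewrite gtrDl subr_lt0.
have -> : b = (a * d - 1) / D by rewrite -W; field.
apply/eqP; rewrite -subr_eq0; apply/eqP.
transitivity (D * (e ^+ 2 - (x ^+ 2 + D ^- 2))); last by rewrite e2 subrr mulr0.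
by rewrite /x; field.
Qed.

(** Shooting from 0: [u1 - s u2] meets the left condition for every [s], and the right condition is
    the quadratic equation. A zero at [t > 0] would mean [s = u1 t / u2 t], but this quotient
    decreases in [t] and its value at [L] already exceeds [s]. *)
Lemma steklov_mode_exists p (B L mu : R) : continuous p ->
  (forall t, 0 < p t) -> (forall t, p t <= B) -> 0 < L -> 0 <= mu ->
  exists s u v, steklov_mode p L mu s u v.
Proof.
move=> cp p0 pB L0 mu0.
have pB' t : `|p t| <= Num.max B mu by rewrite gtr0_norm // le_max pB.
have muB (t : R) : `|mu| <= Num.max B mu by rewrite ger0_norm // le_max lexx orbT.
have cmu : continuous (fun _ : R => mu) by move=> t; apply: cvg_cst.
have [u1 [v1 [u10 v10 du1 dv1]]] := linear_system_solution 1 0 cp cmu pB' muB.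
have [u2 [v2 [u20 v20 du2 dv2]]] := linear_system_solution 0 1 cp cmu pB' muB.
have S1 : radial_solution p mu u1 v1 by split.
have S2 : radial_solution p mu u2 v2 by split.
have W t : u1 t * v2 t - u2 t * v1 t = 1.
  by rewrite (wronskian_constant t S1 S2) u10 v20 u20 mul0r mulr1 subr0.
have u2_neq0 := radial_solution_from_zero p0 mu0 S2 u20 v20.
have [s [sa sE]] := steklov_quadratic_root (u2_neq0 L L0) (W L).
have S := radial_solution_lin 1 (- s) S1 S2.
exists s; do 2 eexists; split; first exact: S.
- by rewrite /= u10 u20; ring.
- by rewrite /= v10 v20; ring.
- by rewrite /= !mulNr !mul1r sE.
apply: (nonvanishing_gt0 (ltW L0)).
- by apply: within_is_derive => t _; apply: S.1.
- by rewrite /= u10 u20 mulr1 mulr0 addr0 ltr01.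
move=> t /andP[]; rewrite le_eqVlt => /orP[/eqP <- _|t0 tL].
  by rewrite /= u10 u20 mulr1 mulr0 addr0 oner_eq0.
(* By the Wronskian identity, [(u1 / u2)' = - p / u2 ^+ 2]. *)
have decr : u1 L / u2 L <= u1 t / u2 t.
  rewrite -lerN2.
  have dq r : t <= r <= L -> is_derive r 1 (fun z => - (u1 z / u2 z)) (p r / u2 r ^+ 2).
    move=> /andP[tr _]; have r0 := lt_le_trans t0 tr.
    have := is_deriveN (is_derive_div (u2_neq0 r r0) (du1 r) (du2 r)).
    congr is_derive; rewrite -[X in _ = X / _]mulr1 -(W r); ring.
  apply: (is_derive_ge0_le tL dq) => r _.
  by rewrite divr_ge0 ?sqr_ge0 ?ltW.
apply/eqP => E; have : s < s.
  apply: lt_le_trans sa _; apply: le_trans decr _.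
  suff -> : u1 t = s * u2 t by rewrite mulfK // u2_neq0.
  by apply/eqP; rewrite -subr_eq0 -mulNr -[u1 t]mul1r E.
by rewrite ltxx.
Qed.

Lemma steklov_mode_bound p L mu s u v : (forall t, 0 < p t) -> 0 < L -> 0 <= mu ->
  steklov_mode p L mu s u v ->
  s <= L * mu / 2 /\ (0 < mu -> s < L * mu / 2).
Proof.
move=> p0 L0 mu0 [[du dv] u0 v0 vL ugt0].
(* If equality held, [k] would be constant and [w] would vanish in both halves of
   the interval, whereas [w t - mu t] is then constant. *)
pose w t := v t / u t; pose k t := mu * t - w t.
have dk t : 0 <= t <= L -> is_derive t 1 k (p t * w t ^+ 2).
  move=> /ugt0/lt0r_neq0 ut.
  have dmu : is_derive t 1 (fun z : R => mu * z) mu.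
    by rewrite -[X in is_derive _ _ _ X]mulr1; apply: (is_deriveZ mu (is_derive_id t 1)).
  have := is_deriveB dmu (is_derive_div ut (dv t) (du t)).
  by congr is_derive; rewrite /w; field.
have dk_ge0 t : 0 <= p t * w t ^+ 2 by rewrite mulr_ge0 ?sqr_ge0 ?ltW.
have uL : u L != 0 by rewrite gt_eqF // ugt0 // lexx ltW.
have k0 : k 0 = s by rewrite /k /w u0 v0 mulr0 sub0r divr1 opprK.
have kL : k L = mu * L - s by rewrite /k /w vL mulfK.
have h0 : 0 < L / 2 by rewrite divr_gt0.
have hL : L / 2 < L by lra.
have k1 : k 0 <= k (L / 2).
  apply: (is_derive_ge0_le (ltW h0) _ (fun t _ => dk_ge0 t)) => t /andP[t0 th].
  by apply: dk; rewrite t0 (le_trans th (ltW hL)).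
have k2 : k (L / 2) <= k L.
  apply: (is_derive_ge0_le (ltW hL) _ (fun t _ => dk_ge0 t)) => t /andP[t0 th].
  by apply: dk; rewrite th (le_trans (ltW h0) t0).
split; first by lra.
move=> mu_gt0; rewrite lt_neqAle; apply/andP; split; last by lra.
apply/eqP => sE.
have E1 : k (L / 2) - k 0 = 0 by lra.
have E2 : k L - k (L / 2) = 0 by lra.
have wz c : p c * w c ^+ 2 = 0 -> w c = 0.
  by move=> /eqP; rewrite mulf_eq0 gt_eqF //= sqrf_eq0 => /eqP.
have [c /andP[c0 ch]] : exists2 c, 0 < c < L / 2 & k (L / 2) - k 0 = p c * w c ^+ 2 * (L / 2 - 0).
  apply: (is_derive_MVT h0) => t /andP[t0 th].
  by apply: dk; rewrite t0 (le_trans th (ltW hL)).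
rewrite E1 subr0 => /esym/eqP; rewrite mulf_eq0 [L / 2 == 0]gt_eqF // orbF => /eqP/wz wc.
have [d /andP[hd dL]] : exists2 c, L / 2 < c < L & k L - k (L / 2) = p c * w c ^+ 2 * (L - L / 2).
  apply: (is_derive_MVT hL) => t /andP[t0 th].
  by apply: dk; rewrite th (le_trans (ltW h0) t0).
rewrite E2 => /esym/eqP; rewrite mulf_eq0 [L - L / 2 == 0]gt_eqF ?subr_gt0 // orbF => /eqP/wz wd.
have : k c <= k (L / 2).
  apply: (is_derive_ge0_le (ltW ch) _ (fun t _ => dk_ge0 t)) => t /andP[t0 th].
  by apply: dk; rewrite (le_trans (ltW c0) t0) (le_trans th (ltW hL)).
have : k 0 <= k c.
  apply: (is_derive_ge0_le (ltW c0) _ (fun t _ => dk_ge0 t)) => t /andP[t0 th].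
  by apply: dk; rewrite t0 (le_trans th) // (le_trans (ltW ch) (ltW hL)).
have : k (L / 2) <= k d.
  apply: (is_derive_ge0_le (ltW hd) _ (fun t _ => dk_ge0 t)) => t /andP[t0 th].
  by apply: dk; rewrite (le_trans (ltW h0) t0) (le_trans th (ltW dL)).
have : k d <= k L.
  apply: (is_derive_ge0_le (ltW dL) _ (fun t _ => dk_ge0 t)) => t /andP[t0 th].
  by apply: dk; rewrite th (le_trans (ltW h0)) // (le_trans (ltW hd) t0).
have : mu * c < mu * d by rewrite ltr_pM2l // (lt_trans ch hd).
have kc : k c = mu * c by rewrite /k wc subr0.
have kd : k d = mu * d by rewrite /k wd subr0.
lra.
Qed.

(** Sturm comparison: [v' u - v u'] has derivative [(mu' - mu) u u'], of constant sign by positivity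
    of both modes, yet it vanishes at both ends when the two modes share [s]. Primes here mark the
    second mode. *)
Lemma steklov_mode_inj p L mu mu' s u v u' v' : 0 < L ->
  steklov_mode p L mu s u v -> steklov_mode p L mu' s u' v' -> mu = mu'.
Proof.
suff no_lt nu nu' w z w' z' : 0 < L -> steklov_mode p L nu s w z ->
    steklov_mode p L nu' s w' z' -> nu < nu' -> False.
  by move=> L0 M M'; have [/(no_lt _ _ _ _ _ _ L0 M M')|/(no_lt _ _ _ _ _ _ L0 M' M)|] := ltgtP mu mu'.
move=> {mu mu' u v u' v'}.
move: nu nu' w z w' z' => mu mu' u v u' v'.
move=> L0 [[du dv] u0 v0 vL ugt0] [[du' dv'] u'0 v'0 v'L u'gt0] lt_mu.
have : v' 0 * u 0 - v 0 * u' 0 < v' L * u L - v L * u' L.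
  apply: (@is_derive_gt0_lt _ (fun t => v' t * u t - v t * u' t)
    (fun t => (mu' - mu) * (u t * u' t)) _ _ L0) => t.
    move=> _; have := is_deriveB (is_derive_mul (dv' t) (du t)) (is_derive_mul (dv t) (du' t)).
    by congr is_derive; ring.
  move=> /andP[/ltW t0 /ltW tL].
  by rewrite !mulr_gt0 ?subr_gt0 ?ugt0 ?u'gt0 // t0 tL.
rewrite u0 v0 vL u'0 v'0 v'L; lra.
Qed.

End SteklovMode.

(** * Functions of class C^k *)

Section CkCalculus.
Context {R : realType}.

Lemma continuous_at_near_eq (V W : topologicalType) (f g : V -> W) (x : V) :
  (\near x, f x = g x) -> {for x, continuous f} -> {for x, continuous g}.
Proof.
move=> fg cf; have E : f x = g x := nbhs_singleton fg.
change (g @ x --> g x); rewrite -E.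
by apply: cvg_trans (cf : f @ x --> f x); apply: near_eq_cvg; apply: filterS fg.
Qed.

Lemma C_k_eq (V W : normedModType R) k (O : set V) (f g : V -> W) : open O ->
  (forall x, O x -> f x = g x) -> C_k k O f -> C_k k O g.
Proof.
move=> oO; have near_fg (f' g' : V -> W) x : (forall x, O x -> f' x = g' x) ->
    O x -> \near x, f' x = g' x.
  move=> fg Ox; have : nbhs x O by apply: open_nbhs_nbhs; split.
  by apply: filterS => y; apply: fg.
elim: k f g => [|k IH] f g fg /= [cf Df]; split.
- by move=> x Ox; apply: continuous_at_near_eq (cf x Ox); apply: near_fg.
- by [].
- by move=> x Ox; apply: continuous_at_near_eq (cf x Ox); apply: near_fg.
move=> v; have [dv Dv] := Df v; split=> [x Ox|].
  by apply: near_eq_derivable (dv x Ox); apply: near_fg.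
by apply: IH Dv => x Ox; apply: near_eq_derive; apply: near_fg.
Qed.

Lemma C_k_sub (V W : normedModType R) k (O O' : set V) (f : V -> W) :
  O' `<=` O -> C_k k O f -> C_k k O' f.
Proof.
move=> sO; elim: k f => [|k IH] f /= [cf Df]; split => //; try by move=> x /sO/cf.
by move=> v; have [dv Dv] := Df v; split=> [x /sO/dv//|]; apply: IH.
Qed.

Lemma C_k_continuous (V W : normedModType R) k (O : set V) (f : V -> W) x :
  C_k k O f -> O x -> {for x, continuous f}.
Proof. by case: k => [|k] [cf _]; apply: cf. Qed.

Lemma C_kW (V W : normedModType R) k (O : set V) (f : V -> W) :
  C_k k.+1 O f -> C_k k O f.
Proof.
elim: k f => [|k IH] f [cf Df]; split=> // v.
by have [dv Dv] := Df v; split => //; apply: IH.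
Qed.

Lemma C_k_local (V W : normedModType R) k (O : set V) (f : V -> W) :
  (forall x, O x -> exists (U : set V) (F : V -> W),
     [/\ open U, U x, C_k k U F & forall y, U y -> f y = F y]) -> C_k k O f.
Proof.
move=> H.
have {}H x : O x -> exists U : set V, [/\ open U, U x & C_k k U f].
  move=> /H[U [F [oU Ux CF fF]]]; exists U; split => //.
  by apply: C_k_eq CF => // y Uy; rewrite fF.
elim: k f H => [|k IH] f H; split => //; try by move=> x /H[U [_ Ux]] /C_k_continuous; apply.
move=> v; split=> [x /H[U [_ Ux [_ /(_ v)[+ _]]]]|]; first exact.
by apply: IH => x /H[U [oU Ux [_ /(_ v)[_ C]]]]; exists U.
Qed.

Lemma C_k_cst (V W : normedModType R) k (O : set V) (c : W) : C_k k O (fun=> c).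
Proof.
elim: k c => [|k IH] c; split=> //; try by move=> x _; apply: cvg_cst.
move=> v; split=> [x _|]; first exact: derivable_cst.
have -> // : (fun x : V => 'D_v (fun=> c) x) = (fun=> 0).
by apply/funext => x; exact: derive_cst.
Qed.

Lemma C_k_add (V W : normedModType R) k (O : set V) (f g : V -> W) : open O ->
  C_k k O f -> C_k k O g -> C_k k O (fun x => f x + g x).
Proof.
move=> oO; elim: k f g => [|k IH] f g [cf Df] [cg Dg]; split => //;
  try by move=> x Ox; apply: cvgD; [exact: cf|exact: cg].
move=> v; have [df Cf] := Df v; have [dg Cg] := Dg v.
split=> [x Ox|]; first by apply: derivableD; [exact: df|exact: dg].
apply: C_k_eq (IH _ _ Cf Cg) => // x Ox.
by rewrite (deriveD (df x Ox) (dg x Ox)).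
Qed.

Lemma C_k_mul (V : normedModType R) k (O : set V) (f g : V -> R) : open O ->
  C_k k O f -> C_k k O g -> C_k k O (fun x => f x * g x).
Proof.
move=> oO; elim: k f g => [|k IH] f g Hf Hg.
  by split=> // x Ox; apply: cvgM; [exact: Hf.1|exact: Hg.1].
split=> [x Ox|v]; first by apply: cvgM; [exact: Hf.1|exact: Hg.1].
have [df Cf] := Hf.2 v; have [dg Cg] := Hg.2 v.
split=> [x Ox|]; first by apply: derivableM; [exact: df|exact: dg].
apply: C_k_eq (C_k_add oO (IH _ _ (C_kW Hf) Cg) (IH _ _ (C_kW Hg) Cf)) => // x Ox.
by rewrite (deriveM (df x Ox) (dg x Ox)).
Qed.

Lemma C_k_inv (V : normedModType R) k (O : set V) (f : V -> R) : open O ->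
  (forall x, O x -> f x != 0) -> C_k k O f -> C_k k O (fun x => (f x)^-1).
Proof.
move=> oO f0; elim: k => [|k IH] Hf.
  by split=> // x Ox; apply: cvgV; [exact: f0|exact: Hf.1].
split=> [x Ox|v]; first by apply: cvgV; [exact: f0|exact: Hf.1].
have [df Cf] := Hf.2 v.
split=> [x Ox|]; first by apply: derivableV; [exact: f0|exact: df].
have Cinv := IH (C_kW Hf).
have C := C_k_mul oO (C_k_mul oO (C_k_cst k O (-1 : R)) (C_k_mul oO Cinv Cinv)) Cf.
apply: C_k_eq C => // x Ox.
by rewrite (deriveV (f0 x Ox) (df x Ox)) mulN1r -expr2 exprVn.
Qed.

(** The difference quotients of [f \o l] at [x] along [v] are literally those of [f] at [l x] along
    [l v], so directional derivatives transfer without a chain rule. *)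
Lemma C_k_comp_linear (V V' W : normedModType R) k (O : set V') (l : V -> V')
    (f : V' -> W) :
  continuous l -> (forall (a : R) x y, l (a *: x + y) = a *: l x + l y) ->
  C_k k O f -> C_k k (l @^-1` O) (f \o l).
Proof.
move=> cl ll; elim: k f => [|k IH] f [cf Df]; split => //;
  try by move=> x Ox; apply: continuous_comp; [exact: cl|exact: cf].
have slope v x : (fun h : R => h^-1 *: (((f \o l) \o shift x) (h *: v) - (f \o l) x)) =
    (fun h : R => h^-1 *: ((f \o shift (l x)) (h *: l v) - f (l x))).
  by apply/funext => h; rewrite /= ll.
move=> v; have [df Cf] := Df (l v); split=> [x Ox|].
  by rewrite /derivable slope; apply: df.
rewrite (_ : (fun x => _) = (fun y => 'D_(l v) f y) \o l); first exact: IH.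
by apply/funext => x; rewrite /derive slope.
Qed.

Lemma is_derive_dir (f : R -> R) (t d v : R) : is_derive t 1 f d ->
  is_derive t v f (v * d).
Proof.
move=> [df Df]; have Hd : differentiable f t by exact/derivable1_diffP.
apply: DeriveDef; first exact: diff_derivable.
by rewrite deriveE // -[in LHS](mulr1 v) -[v * 1]/(v *: 1) linearZ /= -deriveE // Df.
Qed.

Lemma C_k_is_derive k (O : set R) (f g : R -> R) : open O ->
  (forall t : R, O t -> is_derive t 1 f (g t)) -> C_k k O g -> C_k k.+1 O f.
Proof.
move=> oO dfg Cg; split=> [t Ot|v]; first exact: is_derive_continuous (dfg t Ot).
split=> [t Ot|]; first by have [] := is_derive_dir v (dfg t Ot).
apply: C_k_eq (C_k_mul oO (C_k_cst k O v) Cg) => // t Ot.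
by have [_ ->] := is_derive_dir v (dfg t Ot).
Qed.

(** Bootstrap: if [u] and [v] are of class C^k on [O], so are their derivatives [p v] and [mu u],
    and both functions gain one order. *)
Lemma radial_solution_smooth (O : set R) (p u v : R -> R) (mu : R) : open O ->
  smooth O p -> radial_solution p mu u v -> smooth O u /\ smooth O v.
Proof.
move=> oO Cp [du dv]; suff H k : C_k k O u /\ C_k k O v by split=> k; have [] := H k.
elim: k => [|k [Cu Cv]].
  by split; split=> // t _; [exact: is_derive_continuous (du t)|exact: is_derive_continuous (dv t)].
split.
  by apply: C_k_is_derive (fun t _ => du t) _ => //; apply: C_k_mul.
by apply: C_k_is_derive (fun t _ => dv t) _ => //; apply: C_k_mul => //; apply: C_k_cst.
Qed.

End CkCalculus.

(** * Extension of the warping function *)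

Section WarpExtension.
Context {R : realType}.

Lemma open_itvoo (a b : R) : open (`]a, b[%classic : set R).
Proof. by apply: interval_open. Qed.

Lemma smooth_continuous (V W : normedModType R) (O : set V) (f : V -> W) x :
  smooth O f -> O x -> {for x, continuous f}.
Proof. by move=> /(_ 0%N)[cf _] /cf. Qed.

Lemma smooth_within_gt0_extension (A : set R) (h : R -> R) (a : R) :
  smooth_within A h -> A a -> 0 < h a -> exists (e : R) (F : R -> R),
    [/\ 0 < e, smooth (ball a e) F, forall t, ball a e t -> 0 < F t
      & forall t, A t -> ball a e t -> h t = F t].
Proof.
move=> sh Aa ha; have [U [F [oU Ua sF hF]]] := sh a Aa.
have : \forall t \near a, U t /\ 0 < F t.
  near=> t; split; first by near: t; apply: open_nbhs_nbhs; split.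
  near: t; have /cvgr_gt := smooth_continuous sF Ua.
  by apply; rewrite -hF.
move=> /nbhs_ballP[e /= e0 He]; exists e, F; split => //.
- by move=> k; apply: C_k_sub (sF k) => t /He[].
- by move=> t /He[].
- by move=> t At /He[Ut _]; apply: hF.
Unshelve. all: by end_near. Qed.

(** The local extensions at 0 and at [L] are glued to [h]; they agree with [h] on the overlaps, and
    continuity keeps them positive slightly beyond the ends. *)
Lemma warp_extension (h : R -> R) (L : R) : 0 < L ->
  smooth_within [set t : R | 0 <= t <= L] h ->
  (forall t, 0 <= t <= L -> 0 < h t) ->
  exists (e : R) (H : R -> R), [/\ 0 < e, smooth `]- e, L + e[ H,
    forall t, t \in `]- e, L + e[ -> 0 < H t & forall t, 0 <= t <= L -> H t = h t].
Proof.
move=> L0 sh h0.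
have [||e0 [F0 [e0_gt0 sF0 F0_gt0 hF0]]] := smooth_within_gt0_extension (a := 0) sh.
- by rewrite /= lexx ltW.
- by rewrite h0 // lexx ltW.
have [||e1 [F1 [e1_gt0 sF1 F1_gt0 hF1]]] := smooth_within_gt0_extension (a := L) sh.
- by rewrite /= lexx ltW.
- by rewrite h0 // lexx ltW.
pose H t := if t < 0 then F0 t else if t <= L then h t else F1 t.
(* The bound [e <= L] keeps the piece around 0 to the left of [L] and the piece around [L] to the
   right of 0. *)
pose e := Num.min (Num.min e0 e1) L.
have e_gt0 : 0 < e by rewrite !lt_min e0_gt0 e1_gt0 L0.
have [ee0 ee1 eL] : [/\ e <= e0, e <= e1 & e <= L].
  by rewrite /e !ge_min !lexx !orbT.
have ball0 t : - e < t < e -> ball (0 : R) e0 t.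
  move=> /andP[t1 t2]; rewrite /ball /= sub0r normrN ltr_norml.
  by rewrite (lt_le_trans t2 ee0) andbT (le_lt_trans _ t1) // lerN2.
have ball1 t : L - e < t < L + e -> ball L e1 t.
  move=> /andP[t1 t2]; rewrite /ball /= distrC ltr_norml.
  by apply/andP; split; lra.
have HF0 t : - e < t < e -> H t = F0 t.
  move=> te; rewrite /H; case: ifPn => [//|]; rewrite -leNgt => t0.
  have tL : t <= L by case/andP: te => _ /ltW/le_trans; apply.
  by rewrite tL hF0 //=; [rewrite t0 tL|exact: ball0].
have HF1 t : L - e < t < L + e -> H t = F1 t.
  move=> te; have t0 : 0 < t by case/andP: te => + _; apply: le_lt_trans; rewrite subr_ge0.
  rewrite /H ltNge (ltW t0) /=; case: ifPn => // tL.
  by rewrite hF1 //=; [rewrite tL ltW|exact: ball1].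
have Hh t : 0 <= t <= L -> H t = h t.
  by move=> /andP[t0 tL]; rewrite /H ltNge t0 /= tL.
exists e, H; split => //.
  move=> k; apply: C_k_local => x /=; rewrite in_itv /= => /andP[x1 x2].
  have [x0|x0] := leP x 0.
    exists `]- e, e[%classic, F0; split.
    - exact: open_itvoo.
    - by rewrite /= in_itv /= x1 (le_lt_trans x0 e_gt0).
    - by apply: C_k_sub (sF0 k) => t /=; rewrite in_itv /= => /ball0.
    - by move=> y /=; rewrite in_itv /=; apply: HF0.
  have [xL|xL] := leP L x.
    exists `]L - e, L + e[%classic, F1; split.
    - exact: open_itvoo.
    - by rewrite /= in_itv /= x2 andbT; lra.
    - by apply: C_k_sub (sF1 k) => t /=; rewrite in_itv /= => /ball1.
    - by move=> y /=; rewrite in_itv /=; apply: HF1.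
  have [|O [F [oO Ox sF hF]]] := sh x; first by rewrite /= !ltW.
  exists (O `&` `]0, L[%classic), F; split.
  - by apply: openI => //; exact: open_itvoo.
  - by split => //=; rewrite in_itv /= x0 xL.
  - by apply: C_k_sub (sF k) => t [].
  - move=> y [Oy] /=; rewrite in_itv /= => /andP[/ltW y0 /ltW yL].
    by rewrite Hh ?y0 // hF //= y0.
move=> t; rewrite in_itv /= => /andP[t1 t2].
have [t0|t0] := leP t 0.
  have te : - e < t < e by rewrite t1 (le_lt_trans t0).
  by rewrite HF0 //; apply/F0_gt0/ball0.
have [tL|tL] := leP L t.
  have te : L - e < t < L + e by rewrite t2 andbT; lra.
  by rewrite HF1 //; apply/F1_gt0/ball1.
by rewrite Hh ?h0 ?ltW.
Qed.

Lemma continuous_clamp (a b : R) : continuous (fun t : R => Num.max a (Num.min b t)).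
Proof.
move=> t; apply: (@continuous_max _ _ (cst a) (fun s : R => Num.min b s)).
  exact: cvg_cst.
by apply: (@continuous_min _ _ (cst b) id); [exact: cvg_cst|exact: cvg_id].
Qed.

(** Composing the extended [h] with the clamp onto a compact interval makes [p] continuous, positive
    and bounded on the whole line, as global existence requires; smoothness survives on the interior
    of that interval, which contains [[0, L]]. *)
Lemma radial_coefficient (h : R -> R) (L : R) : 0 < L ->
  smooth_within [set t : R | 0 <= t <= L] h ->
  (forall t, 0 <= t <= L -> 0 < h t) ->
  exists (O : set R) (p : R -> R) (B : R), [/\ open O, [set t | 0 <= t <= L] `<=` O,
    smooth O p, continuous p & [/\ forall t, 0 < p t, forall t, p t <= B
    & forall t, 0 <= t <= L -> p t = (h t) ^- 2]].
Proof.
move=> L0 sh h0.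
have [e [H [e0 sH H0 Hh]]] := warp_extension L0 sh h0.
(* Halving [e] places the compact interval [[a, b]] inside the open one where [H] is smooth and
   positive. *)
pose a := - (e / 2); pose b := L + e / 2.
have ab : a <= b by rewrite /a /b; lra.
pose c (t : R) := Num.max a (Num.min b t).
have cI t : a <= c t <= b by rewrite /c le_max lexx /= ge_max ab ge_min lexx.
have abI t : a <= t <= b -> t \in `]- e, L + e[.
  by rewrite in_itv /= /a /b => /andP[? ?]; apply/andP; split; lra.
have c_id t : a <= t <= b -> c t = t.
  by move=> /andP[t1 t2]; rewrite /c (min_r t2) (max_r t1).
pose p t := (H (c t))^-1 * (H (c t))^-1.
have Hc0 t : 0 < H (c t) by apply/H0/abI/cI.
have cHc : continuous (fun t => (H (c t))^-1).
  move=> t; apply: cvgV; first by rewrite gt_eqF.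
  apply: (@continuous_comp _ _ _ c H); first exact: continuous_clamp.
  by apply: (smooth_continuous sH); apply: abI (cI t).
have cp : continuous p by move=> t; apply: cvgM; apply: cHc.
have [M _ HM] := EVT_max ab (continuous_subspaceT (A := `[a, b]%classic) cp).
exists `]a, b[%classic, p, (p M); split => //.
- by move=> t /= /andP[t0 tL]; rewrite in_itv /= /a /b; apply/andP; split; lra.
- move=> k; have oI : open (`]a, b[%classic : set R) by exact: open_itvoo.
  have sub : `]a, b[ `<=` (`]- e, L + e[ : set R).
    by move=> t /=; rewrite in_itv /= => /andP[/ltW t1 /ltW t2]; apply: abI; rewrite t1.
  have CV := C_k_inv oI (fun t It => lt0r_neq0 (H0 t (sub t It))) (C_k_sub sub (sH k)).
  apply: C_k_eq (C_k_mul oI CV CV) => // t /=.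
  by rewrite in_itv /= => /andP[/ltW t1 /ltW t2]; rewrite /p c_id // t1.
split.
- by move=> t; rewrite /p mulr_gt0 ?invr_gt0.
- move=> t; have -> : p t = p (c t) by rewrite /p (c_id (c t)).
  by apply: HM; rewrite in_itv /=; apply: cI.
- move=> t /andP[t0 tL]; rewrite /p c_id; last by rewrite /a /b; apply/andP; split; lra.
  by rewrite Hh ?t0 // -expr2 exprVn.
Qed.

End WarpExtension.

(** * The Laplacian in warped coordinates *)

Section WarpedCoordinates.
Context {R : realType} {n : nat}.
Implicit Types (y z w : 'rV[R]_(1 + n)).

Lemma coord_t_linear (a : R) y z : coord_t (a *: y + z) = a * coord_t y + coord_t z.
Proof. by rewrite /coord_t !mxE. Qed.

Lemma rsubmx_linear (a : R) y z : rsubmx (a *: y + z) = a *: rsubmx y + rsubmx z.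
Proof. by rewrite linearP. Qed.

Lemma coord_t_continuous : continuous (@coord_t R n).
Proof.
move=> y; rewrite (_ : @coord_t R n = fun z => z 0 (lshift n 0)); last first.
  by apply/funext => z; rewrite /coord_t mxE.
exact: coord_continuous.
Qed.

Lemma rsubmx_continuous : continuous (rsubmx : 'rV[R]_(1 + n) -> 'rV[R]_n).
Proof. by move=> y; apply: differentiable_continuous; apply: differentiable_rsubmx. Qed.

Definition slab (A : set R) (B : set 'rV[R]_n) : set 'rV[R]_(1 + n) :=
  [set z | A (coord_t z) /\ B (rsubmx z)].

Lemma open_slab (A : set R) (B : set 'rV[R]_n) : open A -> open B -> open (slab A B).
Proof.
move=> oA oB; have -> : slab A B = (@coord_t R n) @^-1` A `&` rsubmx @^-1` B by [].
apply: openI; apply: open_comp => //.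
  by move=> y _; apply: coord_t_continuous.
by move=> y _; apply: rsubmx_continuous.
Qed.

Lemma smooth_slab_prod (A : set R) (B : set 'rV[R]_n) (a : R -> R) (b : 'rV[R]_n -> R) :
  open A -> open B -> smooth A a -> smooth B b ->
  smooth (slab A B) (fun z => a (coord_t z) * b (rsubmx z)).
Proof.
move=> oA oB sa sb k; have oS := open_slab oA oB; apply: C_k_mul => //.
  have H := C_k_comp_linear coord_t_continuous coord_t_linear (sa k).
  by apply: C_k_sub H => z [].
have H := C_k_comp_linear rsubmx_continuous rsubmx_linear (sb k).
by apply: C_k_sub H => z [].
Qed.

(* No derivability is needed: both sides are the junk value 0 when [b] is not
   derivable along [v] (and [c != 0]). *)
Lemma derive_scale (V : normedModType R) (c : R) (b : V -> R) (x v : V) :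
  'D_v (fun r => c * b r) x = c * 'D_v b x.
Proof.
have [->|c0] := eqVneq c 0.
  rewrite mul0r (_ : (fun r => _) = cst 0) ?derive_cst //.
  by apply/funext => r; rewrite mul0r.
have [db|ndb] := pselect (derivable b x v); first exact: (@deriveZ _ _ _ b c x v).
have point0 : (point : R) = 0 by [].
rewrite {2}/derive (dvgP ndb) point0 mulr0 -point0; apply: dvgP => dcb; apply: ndb.
suff -> : b = c^-1 \*: (fun r => c * b r) by apply: derivableZ.
apply/funext => r; change (b r = c^-1 * (c * b r)); by rewrite mulKf.
Qed.

Lemma coord_t_delta_t : coord_t (delta_mx 0 (lshift n 0) : 'rV[R]_(1 + n)) = 1.
Proof. by rewrite /coord_t !mxE !eqxx. Qed.

Lemma rsubmx_delta_t : rsubmx (delta_mx 0 (lshift n 0) : 'rV[R]_(1 + n)) = 0.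
Proof. by apply/rowP => j; rewrite !mxE eq_rlshift andbF. Qed.

Lemma coord_t_delta_x k : coord_t (delta_mx 0 (rshift 1 k) : 'rV[R]_(1 + n)) = 0.
Proof. by rewrite /coord_t !mxE eq_lrshift andbF. Qed.

Lemma rsubmx_delta_x k :
  rsubmx (delta_mx 0 (rshift 1 k) : 'rV[R]_(1 + n)) = delta_mx 0 k.
Proof. by apply/rowP => j; rewrite !mxE eq_rshift. Qed.

(** Along the first coordinate vector [rsubmx] is constant, so the quotient is that of [a] times the
    number [b (rsubmx z)]. *)
Lemma derive_slab_t (a : R -> R) (b : 'rV[R]_n -> R) z (d : R) :
  is_derive (coord_t z) 1 a d ->
  'D_(delta_mx 0 (lshift n 0)) (fun y => a (coord_t y) * b (rsubmx y)) z =
  d * b (rsubmx z).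
Proof.
move=> [_ <-]; rewrite mulrC -derive_scale; apply: (f_equal (fun q : R -> R => lim (q @ 0^'))).
apply/funext => h /=.
by rewrite !coord_t_linear !rsubmx_linear coord_t_delta_t rsubmx_delta_t scaler0 add0r -!(mulrC (b _)).
Qed.

Lemma derive_slab_x (a : R -> R) (b : 'rV[R]_n -> R) z k :
  'D_(delta_mx 0 (rshift 1 k)) (fun y => a (coord_t y) * b (rsubmx y)) z =
  a (coord_t z) * 'D_(delta_mx 0 k) b (rsubmx z).
Proof.
rewrite -derive_scale; apply: (f_equal (fun q : R -> R => lim (q @ 0^'))).
apply/funext => h /=.
by rewrite !coord_t_linear !rsubmx_linear coord_t_delta_x rsubmx_delta_x mulr0 add0r.
Qed.

End WarpedCoordinates.

Lemma posdef_det_gt0 (F : realFieldType) (g : 'M[F]_2) : g^T = g ->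
  (forall v : 'rV[F]_2, v != 0 -> 0 < (v *m g *m v^T) 0 0) -> 0 < \det g.
Proof.
move=> gT g0.
have quad (v : 'rV[F]_2) : (v *m g *m v^T) 0 0 = v 0 0 ^+ 2 * g 0 0 +
    v 0 0 * v 0 1 * (g 0 1 + g 1 0) + v 0 1 ^+ 2 * g 1 1.
  rewrite !mxE !big_ord_recl !big_ord0 !mxE !big_ord_recl !big_ord0.
  by rewrite (_ : lift ord0 ord0 = 1); [ring|apply/val_inj].
have g10 : g 1 0 = g 0 1 by rewrite -{1}gT mxE.
have g00 : 0 < g 0 0.
  have := g0 (\row_j (j == 0)%:R); rewrite quad !mxE /= !(mulr1, mul1r, mulr0, mul0r, addr0, expr1n, expr0n) /=.
  apply; apply/eqP => /rowP/(_ 0); rewrite !mxE => /eqP; rewrite oner_eq0 //.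
have detE : \det g = g 0 0 * g 1 1 - g 0 1 * g 0 1.
  rewrite (expand_det_row _ 0) !big_ord_recl big_ord0 /cofactor !det_mx11 !mxE.
  have l01 : lift ord0 ord0 = 1 :> 'I_2 by apply/val_inj.
  have l10 : lift (1 : 'I_2) (ord0 : 'I_1) = 0 by apply/val_inj.
  rewrite l01 l10.
  by rewrite g10 /= expr0 expr1; ring.
(* The quadratic form takes the value [g 0 0 * \det g] at this vector. *)
have := g0 (\row_j (if j == 0 then - g 0 1 else g 0 0)).
rewrite quad !mxE /= g10 detE => H.
have {}H : 0 < g 0 0 * (g 0 0 * g 1 1 - g 0 1 * g 0 1).
  apply: lt_le_trans (H _) _.
    by apply/eqP => /rowP/(_ 1); rewrite !mxE /= => /eqP; rewrite gt_eqF.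
  by rewrite le_eqVlt; apply/orP; left; apply/eqP; ring.
by move: H; rewrite pmulr_rgt0.
Qed.

Section WarpedMetric.
Context {R : realType} (Sigma : riemannian_manifold R 2) (h : R -> R)
  (i : chart_index Sigma).
Local Notation g := (metric i).

Lemma det_metric_gt0 x : chart_img i x -> 0 < \det (g x).
Proof.
move=> ix; apply: posdef_det_gt0; first exact: Defs.metric_sym.
by move=> v; apply: metric_posdef.
Qed.

Lemma metric_unitmx x : chart_img i x -> g x \in unitmx.
Proof. by move=> ix; rewrite unitmxE unitfE gt_eqF ?det_metric_gt0. Qed.

(** Here the dimension of [Sigma] matters: the determinant scales by [h^4], so its root scales by
    [h^2], exactly cancelling the [h^-2] in the tangential part of the inverse metric. *)
Lemma sqrt_det_warped (z : 'rV[R]_(1 + 2)) :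
  Num.sqrt (\det (warped_metric h i z)) =
  h (coord_t z) ^+ 2 * Num.sqrt (\det (g (rsubmx z))).
Proof.
rewrite /warped_metric det_ublock det1 mul1r detZ sqrtrM ?sqr_ge0 //.
  by rewrite sqrtr_sqr ger0_norm ?sqr_ge0.
Qed.

Lemma invmx_warped (z : 'rV[R]_(1 + 2)) : h (coord_t z) != 0 -> chart_img i (rsubmx z) ->
  invmx (warped_metric h i z) =
  block_mx 1%:M 0 0 (h (coord_t z) ^- 2 *: invmx (g (rsubmx z))).
Proof.
move=> h0 iz; have gu := metric_unitmx iz.
have h2 : h (coord_t z) ^+ 2 \is a GRing.unit by rewrite unitfE expf_neq0.
rewrite /warped_metric invmx_block_diag ?invmx1 ?invmxZ //.
  by rewrite unitmxE detZ unitrM unitrX // -unitmxE.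
by rewrite unitmxE det_ublock det1 mul1r detZ unitrM unitrX // -unitmxE.
Qed.

(** The function [b] stands for [h^2 a'] and [c] for its derivative, so that only first derivatives
    along [t] are taken. *)
Lemma laplace_beltrami_warped (O : set R) (a b : R -> R) (f : 'rV[R]_2 -> R) (c : R) z :
  open O -> O (coord_t z) -> chart_img i (rsubmx z) ->
  (forall t, O t -> h t != 0) ->
  (forall t, O t -> is_derive t 1 a (h t ^- 2 * b t)) ->
  is_derive (coord_t z) 1 b c ->
  laplace_beltrami (warped_metric h i) (fun y => a (coord_t y) * f (rsubmx y)) z =
  h (coord_t z) ^- 2 *
    (c * f (rsubmx z) + a (coord_t z) * laplace_beltrami g f (rsubmx z)).
Proof.
move=> oO Oz iz h0 da db.
have oN : open (slab O (chart_img i)) by apply: open_slab => //; exact: codom_open.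
have nN : \forall y \near z, slab O (chart_img i) y by apply: open_nbhs_nbhs; split.
pose S x := Num.sqrt (\det (g x)).
pose flux k x := \sum_(j < 2) S x * invmx (g x) k j * 'D_(delta_mx 0 j) f x.
rewrite /laplace_beltrami sqrt_det_warped big_split_ord /= big_ord1.
(* Radial term: near [z] the flux along [t] is [b(t)] times [S f], because the two powers of [h]
   cancel. *)
rewrite (_ : 'D__ _ z = c * (S (rsubmx z) * f (rsubmx z))); last first.
  rewrite -(derive_slab_t (fun x => S x * f x) db); apply: near_eq_derive.
  apply: filterS nN => y [Oy iy].
  rewrite big_split_ord /= big_ord1 big1 => [|j _].
    rewrite addr0 sqrt_det_warped invmx_warped ?h0 // block_mxEul mxE eqxx.
    rewrite (derive_slab_t f (da _ Oy)) /S.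
    rewrite mulr1; field; exact: h0.
  by rewrite invmx_warped ?h0 // block_mxEur mxE mulr0 mul0r.
(* Tangential terms: near [z] each flux component is [a(t)] times the corresponding flux of [f] on
   [Sigma]. *)
rewrite (eq_bigr (fun k => a (coord_t z) * 'D_(delta_mx 0 k) (flux k) (rsubmx z))); last first.
  move=> k _; rewrite -derive_slab_x; apply: near_eq_derive.
  apply: filterS nN => y [Oy iy].
  rewrite big_split_ord /= big_ord1 invmx_warped ?h0 // block_mxEdl mxE mulr0 mul0r add0r.
  rewrite mulr_sumr; apply: eq_bigr => j _.
  rewrite block_mxEdr derive_slab_x sqrt_det_warped mxE /S.
  by field; exact: h0.
rewrite -mulr_sumr -/(S (rsubmx z)).
have hz := h0 _ Oz.
have S0 : S (rsubmx z) != 0 by rewrite gt_eqF // sqrtr_gt0 det_metric_gt0.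
rewrite -/(laplace_beltrami g f) /laplace_beltrami -/(S (rsubmx z)).
move: (\sum_(k < 2) _) => Q.
by field; rewrite S0 hz.
Qed.

End WarpedMetric.

(** * From the spectrum of Sigma to Steklov eigenvalues *)

Section Boundary.
Context {R : realType}.

Lemma is_derive_cvg_right (f : R -> R) (t d : R) : is_derive t 1 f d ->
  (f (t + e) - f t) / e @[e --> 0^'+] --> d.
Proof.
move=> [df <-].
have H : (fun e => (f (t + e) - f t) / e) = 
   (fun e => e^-1 *: ((f \o shift t) (e *: (1 : R)) - f t)).
  by apply/funext => e; rewrite /= -[e *: 1]/(e * 1) mulr1 mulrC (addrC t).
by rewrite H; apply: cvg_dnbhs_at_right.
Qed.

Lemma is_derive_cvg_left (f : R -> R) (t d : R) : is_derive t 1 f d ->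
  (f t - f (t - e)) / e @[e --> 0^'+] --> d.
Proof.
move=> df.
have dr : is_derive (0 : R) 1 (fun e : R => t - e) (-1).
  rewrite -[X in is_derive _ _ _ X]add0r.
  by apply: (@is_deriveD _ _ _ (cst t) (fun e => - e)).
have dg : is_derive (0 : R) 1 (fun e : R => f (t - e)) (- d).
  rewrite -mulrN1; apply: (@is_derive1_comp _ f (fun e => t - e)) => //.
  by rewrite subr0.
have H := cvgN (is_derive_cvg_right dg); rewrite opprK in H.
rewrite (_ : (fun e => (f t - f (t - e)) / e) =
  (fun e => - ((f (t - (0 + e)) - f (t - 0)) / e))); first exact: H.
by apply/funext => e; rewrite add0r subr0 -mulNr opprB.
Qed.

End Boundary.

Lemma radial_eigenfunction (R : realType) (Sigma : riemannian_manifold R 2) (L mu s : R)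
    (h p u v : R -> R) (O : set R) (phi : Sigma -> R) :
  0 < L -> (forall t, 0 <= t <= L -> 0 < h t) -> h 0 = 1 -> h L = 1 ->
  open O -> [set t | 0 <= t <= L] `<=` O -> smooth O p ->
  (forall t, 0 <= t <= L -> p t = h t ^- 2) ->
  steklov_mode p L mu s u v -> laplace_eigenspace mu phi ->
  @steklov_eigenspace R 2 Sigma L h s (fun q => u q.1 * phi q.2).
Proof.
move=> L0 h_gt0 h0 hL oO IO sp pE [sol u0 v0 vL _] Ephi.
have [su _] := radial_solution_smooth oO sp sol; have [du dv] := sol.
(* At both ends [p = 1], so [v] is the derivative of [u] there and the end values of the mode become
   the Steklov condition. *)
have [p0 pL] : p 0 = 1 /\ p L = 1.
  by rewrite !pE ?lexx ?ltW // h0 hL expr1n invr1.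
split.
- move=> i z [/= zt zx]; have [sphi _] := Ephi i.
  exists (slab O (chart_img i)),
    (fun y => u (coord_t y) * (phi \o chart_inv i) (rsubmx y)); split => //.
  + by apply: open_slab => //; exact: codom_open.
  + by split => //; apply: IO.
  + by apply: smooth_slab_prod => //; exact: codom_open.
- move=> i z [/= zt zx]; have [_ /(_ _ zx) eqphi] := Ephi i.
  (* The equation is checked on the open interval, since [p] is known to equal [h^-2] only on
     [[0, L]]; smoothness above used the larger set [O]. *)
  have opI : open (`]0, L[%classic : set R) by exact: open_itvoo.
  have /= := @laplace_beltrami_warped R Sigma h i `]0, L[%classic u v
    (phi \o chart_inv i) (mu * u (coord_t z)) z opI.
  rewrite in_itv /= => /(_ zt zx) H; rewrite [LHS]H.
  + rewrite -[laplace_beltrami _ _ _]opprK eqphi /=.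
    by rewrite mulrN (mulrCA (u _)) mulrA subrr mulr0.
  + move=> t; rewrite /= in_itv /= => /andP[/ltW t0 /ltW tL].
    by rewrite gt_eqF // h_gt0 // t0.
  + move=> t; rewrite /= in_itv /= => /andP[/ltW t0 /ltW tL].
    by rewrite -pE ?t0.
- move=> q; split => /=.
    have H := cvgM (is_derive_cvg_right (is_deriveN (du 0))) (cvg_cst (phi q)).
    rewrite p0 v0 mul1r (opprK s) in H; rewrite u0 mul1r.
    rewrite (_ : (fun e => - _) =
      (fun e => ((- u) (0 + e) - (- u) 0) / e * phi q)); first exact: H.
    by apply/funext => e; rewrite add0r -[(- u) e]/(- u e) -[(- u) 0]/(- u 0) u0; ring.
  have H := cvgM (is_derive_cvg_left (du L)) (cvg_cst (phi q)).
  rewrite pL vL mul1r -mulrA in H.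
  rewrite (_ : (fun e => _ / e) =
    (fun e => (u L - u (L - e)) / e * phi q)); first exact: H.
  by apply/funext => e; ring.
Qed.

(** * Comparison of multiplicities through eigenspace dimensions *)

Section Dimension.
Context {R : realType} (X Y : Type) (D : set X) (D' : set Y)
  (E : set (X -> R)) (E' : set (Y -> R)) (T : (X -> R) -> Y -> R).
Hypothesis TE : forall f, E f -> E' (T f).
Hypothesis T_inj : forall d (b : 'I_d -> X -> R) (c : 'I_d -> R),
  (forall y, D' y -> \sum_(k < d) c k * T (b k) y = 0) ->
  forall x, D x -> \sum_(k < d) c k * b k x = 0.

(** The rows of [M] are the coordinates of the [T (b k)] in [b']. A nonzero row vector killing [M]
    would be a linear relation among these images, which [T_inj] pulls back to the free family
    [b]. *)
Lemma has_dim_le d d' : has_dim D E d -> has_dim D' E' d' -> (d <= d')%N.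
Proof.
move=> [b [Eb free_b _]] [b' [_ _ span_b']].
have /choice[C HC] : forall k, exists c : 'I_d' -> R,
    forall y, D' y -> T (b k) y = \sum_(l < d') c l * b' l y.
  by move=> k; apply: span_b'; apply: TE.
pose M : 'M[R]_(d, d') := \matrix_(k, l) C k l.
have [/eqP <-|] := boolP (row_free M); first exact: rank_leq_col.
rewrite -kermx_eq0 => /rowV0Pn[w /sub_kermxP wM].
case/eqP; apply/rowP => k; rewrite mxE.
apply: (free_b (w 0)); apply: T_inj => y D'y.
transitivity (\sum_(l < d') (w *m M) 0 l * b' l y).
  under eq_bigr => i _ do rewrite HC // mulr_sumr.
  rewrite exchange_big; apply: eq_bigr => l _; rewrite mxE mulr_suml.
  by apply: eq_bigr => i _; rewrite mxE mulrA.
by rewrite big1 // => l _; rewrite wM mxE mul0r.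
Qed.

End Dimension.

Lemma is_spectrum_injection (R : realType) (X Y : Type) (D : set X) (D' : set Y)
    (E : R -> set (X -> R)) (E' : R -> set (Y -> R)) (s s' : nat -> R) (mu nu : R) :
  is_spectrum D E s -> is_spectrum D' E' s' ->
  (forall d d', has_dim D (E mu) d -> has_dim D' (E' nu) d' -> (d <= d')%N) ->
  exists f : nat -> nat, (forall n, s n = mu -> s' (f n) = nu) /\
    {in [set n | s n = mu] &, injective f}.
Proof.
move=> [_ _ _ _ /(_ mu)[d [cd Hd]]] [_ _ _ _ /(_ nu)[d' [cd' Hd']]] le_dim.
have : ([set n | s n = mu] #<= [set n | s' n = nu])%card.
  move: cd cd'; rewrite !card_eq_le => /andP[le1 _] /andP[_ le2].
  apply: card_le_trans le1 (card_le_trans _ le2).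
  by rewrite card_le_II le_dim.
move=> /pcard_leP[f]; exists f; split.
  by move=> n sn; have := @funS _ _ _ _ f n; apply.
exact: inj.
Qed.

Theorem theorem1p1 (R : realType) (Sigma : riemannian_manifold R 2)
  (Sigma_compact : compact [set: Sigma]) (Sigma_connected : connected [set: Sigma])
  (Sigma_area : has_area Sigma 1%E)
  (L : R) (L_gt0 : 0 < L)
  (h : R -> R) (h_smooth : smooth_within [set t : R | 0 <= t <= L] h)
  (h_gt0 : forall t, 0 <= t <= L -> 0 < h t)
  (h_0 : h 0 = 1) (h_L : h L = 1)
  (lam sigma : nat -> R)
  (lamE : laplace_spectrum Sigma lam)
  (sigmaE : steklov_spectrum Sigma L h sigma)
  (j : nat) (j_ge1 : (1 <= j)%N) :
  sigma j < L * lam j / 2.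
Proof.
have [U [p [B [oU IU sp cp [p_gt0 pB pE]]]]] := radial_coefficient L_gt0 h_smooth h_gt0.
have [lam0 lam1 lam_le _ _] := lamE; have [_ _ sigma_le _ _] := sigmaE.
have lam_ge0 n : 0 <= lam n by rewrite -lam0 lam_le.
have lamj : 0 < lam j by apply: lt_le_trans lam1 (lam_le _ _ j_ge1).
(* Choosing [s] as a function of [mu] alone makes equal eigenvalues of [Sigma] share one Steklov
   eigenvalue, whose multiplicity is then compared. *)
have /choice[s Hs] : forall mu : R, exists s : R, 0 <= mu ->
    exists u v, steklov_mode p L mu s u v.
  move=> mu; have [mu0|mu0] := leP 0 mu; last by exists 0.
  by have [s Hs] := steklov_mode_exists cp p_gt0 pB L_gt0 mu0; exists s.
have /choice[f Hf] : forall mu : R, exists f : nat -> nat, 0 <= mu ->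
    (forall n, lam n = mu -> sigma (f n) = s mu) /\
    {in [set n | lam n = mu] &, injective f}.
  move=> mu; have [mu0|mu0] := leP 0 mu; last by exists id.
  have [u [v M]] := Hs mu mu0.
  suff [f Hf] : exists f : nat -> nat, (forall n, lam n = mu -> sigma (f n) = s mu) /\
    {in [set n | lam n = mu] &, injective f} by exists f.
  apply: (is_spectrum_injection lamE sigmaE) => d d'.
  apply: (has_dim_le (T := fun phi q => u q.1 * phi q.2)).
    by move=> phi; apply: (radial_eigenfunction L_gt0 h_gt0 h_0 h_L oU IU sp pE M).
  move=> {d'}d b c H x _.
  (* A linear relation among the functions [u phi] is restricted to [t = 0], where [u = 1]. *)
  have Hx : warped_carrier L ((0 : R), x) by rewrite /warped_carrier /= lexx ltW.
  rewrite -[RHS](H _ Hx).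
  by apply: eq_bigr => k _; rewrite /= (mode_u0 M) mul1r.
rewrite ltNge; apply/negP => sigma_ge.
(* Each [f mu] is injective only on the indices of the single eigenvalue [mu]; injectivity of [s]
   prevents collisions between different eigenvalues. *)
pose g n := f (lam n) n.
have sg n : sigma (g n) = s (lam n) by apply: (Hf _ (lam_ge0 n)).1.
have g_lt (n : 'I_j.+1) : (g n < j)%N.
  rewrite ltnNge; apply/negP => /sigma_le; apply/negP; rewrite -ltNge.
  apply: lt_le_trans sigma_ge; rewrite sg.
  have [u [v M]] := Hs _ (lam_ge0 n).
  have [le_s lt_s] := steklov_mode_bound p_gt0 L_gt0 (lam_ge0 n) M.
  have lam_nj : L * lam n / 2 <= L * lam j / 2.
    by rewrite ler_pM2r // ler_pM2l // lam_le // -ltnS.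
  (* When [lam n = 0] the mode bound is not strict, and [lam j > 0] provides the strict inequality
     instead. *)
  have := lam_ge0 n; rewrite le_eqVlt => /orP[/eqP ln0|ln0].
    by apply: le_lt_trans le_s _; rewrite -ln0 mulr0 mul0r divr_gt0 // mulr_gt0.
  exact: lt_le_trans (lt_s ln0) lam_nj.
have g_inj n m : g n = g m -> n = m.
  move=> gE; have sE : s (lam n) = s (lam m) by rewrite -!sg gE.
  have lamE' : lam n = lam m.
    have [u [v M]] := Hs _ (lam_ge0 n); have [u' [v' M']] := Hs _ (lam_ge0 m).
    by rewrite -sE in M'; apply: steklov_mode_inj M M'.
  apply: (Hf _ (lam_ge0 m)).2; rewrite ?inE //=.
  by rewrite -{1}lamE'.
(* Pigeonhole: [g] would inject the [j + 1] indices [0, ..., j] into the [j] indices below [j]. *)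
have := leq_card (fun n => Ordinal (g_lt n)); rewrite !card_ord ltnn => H.
by have := H; rewrite /= => /(_ (fun n m E => val_inj (g_inj n m (congr1 val E)))).
Qed.
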